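(* The space $B^3_{h0}$ admits a basis each member of which is supported in the patch of some vertex of $\mathcal{T}_h$.
   Context: $\Omega\subset\mathbb{R}^2$ is a simply connected polygonal domain and $\mathcal{T}_h$ is a shape-regular triangulation of $\Omega$. $\mathcal{E}_h^i,\mathcal{E}_h^b$ are the interior and boundary edges; $\mathcal{X}_h,\mathcal{X}_h^b$ all vertices and boundary vertices; $\partial_{\mathbf n}$ is the normal derivative on an edge $e$ and $[\![\cdot]\!]$ the jump across $e$. The patch $P_a$ of a vertex $a\in\mathcal{X}_h$ is the union of the triangles of $\mathcal{T}_h$ having $a$ as a vertex. $\mathbb{P}^3_h:=\{w\in L^2(\Omega): w|_T\in P_3(T)\ \forall T\in\mathcal{T}_h\}$; $B_h^3:=\{v\in\mathbb{P}^3_h: v$ is continuous at every $a\in\mathcal{X}_h$; $\int_e[\![v]\!]=0$ and $\int_e p_e[\![\partial_{\mathbf n}v]\!]=0$ for all $p_e\in P_1(e)$, $e\in\mathcal{E}_h^i\}$; $B_{h0}^3:=\{v\in B_h^3: v(a)=0\ \forall a\in\mathcal{X}_h^b;\ \int_e v=0$ and $\int_e p_e\,\partial_{\mathbf n}v=0\ \forall p_e\in P_1(e),\ \forall e\in\mathcal{E}_h^b\}$. *)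

(* Defs.v *)
From HB Require Import structures.
From mathcomp Require Import all_boot all_order all_algebra.
From mathcomp Require Import all_classical all_reals all_analysis.

Set Implicit Arguments.
Unset Strict Implicit.
Unset Printing Implicit Defensive.

Import Order.TTheory GRing.Theory Num.Theory.
Import numFieldNormedType.Exports.

Local Open Scope classical_set_scope.
Local Open Scope ring_scope.

(* The library norm on 'rV[R]_2 is the sup norm; lengths below are Euclidean. *)
Definition enorm (R : realType) (x : 'rV[R]_2) : R :=
  Num.sqrt (x 0 0 ^+ 2 + x 0 1 ^+ 2).

Definition frontier (T : topologicalType) (A : set T) : set T :=
  closure A `\` A°.

(* Convex hull of the points p a, a \in A. *)
Definition hull (R : realType) (I : finType) (p : I -> 'rV[R]_2)
    (A : {set I}) : set 'rV[R]_2 :=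
  [set x | exists c : I -> R,
    [/\ forall a, a \in A -> 0 <= c a,
        \sum_(a in A) c a = 1 & x = \sum_(a in A) c a *: p a]].

(* ordS i is the cyclic successor of i, so the sides are the segments
   [p_i, p_(i+1)]; two of them meet only in their common corner, if any. *)
Definition simple_closed_polygon (R : realType) (G : set 'rV[R]_2) : Prop :=
  exists (n : nat) (p : 'I_n.+3 -> 'rV[R]_2),
    let side i : {set 'I_n.+3} := [set i; ordS i]%SET in
    [/\ injective p,
        forall i j, hull p (side i) `&` hull p (side j)
                    = hull p (side i :&: side j)
      & G = \bigcup_(i in [set: 'I_n.+3]) hull p (side i)].

(* A bounded domain whose boundary consists of finitely many disjoint simple
   closed polygons. The equation (closure Omega)° = Omega says that Omega lies
   on one side of its boundary; it follows from the other clauses by the Jordan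
   curve theorem. *)
Definition polygonal_domain (R : realType) (Omega : set 'rV[R]_2) : Prop :=
  [/\ [/\ Omega !=set0, open Omega & connected Omega],
      bounded_set Omega,
      (closure Omega)° = Omega
    & exists (m : nat) (G : 'I_m -> set 'rV[R]_2),
        [/\ forall i, simple_closed_polygon (G i),
            forall i j, i != j -> G i `&` G j = set0
          & frontier Omega = \bigcup_(i in [set: 'I_m]) G i]].

Definition simply_connected (R : realType) (Omega : set 'rV[R]_2) : Prop :=
  (forall x y, Omega x -> Omega y ->
     exists g : R -> 'rV[R]_2,
       [/\ {within `[0, 1], continuous g}, g @` `[0, 1] `<=` Omega,
           g 0 = x & g 1 = y]) /\
  (forall g : R -> 'rV[R]_2,
     {within `[0, 1], continuous g} -> g @` `[0, 1] `<=` Omega -> g 0 = g 1 ->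
     exists H : R * R -> 'rV[R]_2,
       [/\ {within `[0, 1] `*` `[0, 1], continuous H},
           H @` (`[0, 1] `*` `[0, 1]) `<=` Omega,
           forall t, t \in `[0, 1] -> H (0, t) = g t,
           forall t, t \in `[0, 1] -> H (1, t) = g 0
         & forall s, s \in `[0, 1] -> H (s, 0) = g 0 /\ H (s, 1) = g 0]).

(* A triangle is given by the set of its corners. *)
Record mesh (R : realType) := Mesh {
  vertex : finType;
  pos : vertex -> 'rV[R]_2;
  triangles : {set {set vertex}}
}.

Section Mesh.
Context {R : realType} (M : mesh R).

Definition elt (A : {set vertex M}) : set 'rV[R]_2 := hull (@pos R M) A.

Definition triangulation (Omega : set 'rV[R]_2) : Prop :=
  [/\ injective (@pos R M),
      forall a : vertex M, exists2 T, T \in triangles M & a \in T,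
      forall T, T \in triangles M -> #|T| = 3%N /\ (elt T)° !=set0,
      forall T T', T \in triangles M -> T' \in triangles M ->
        elt T `&` elt T' = elt (T :&: T')
    & closure Omega = \bigcup_(T in [set T | T \in triangles M]) elt T].

(* h_T <= sigma * rho_T for every triangle T, where h_T is the diameter of T
   and rho_T the radius of its largest inscribed disc. *)
Definition shape_regular (sigma : R) : Prop :=
  forall T, T \in triangles M ->
    exists (c : 'rV[R]_2) (rho : R),
      [/\ 0 < rho, [set x | enorm (x - c) <= rho] `<=` elt T
        & forall x y, elt T x -> elt T y -> enorm (x - y) <= sigma * rho].

Definition vertex_patch (a : vertex M) : set 'rV[R]_2 :=
  \bigcup_(T in [set T | T \in triangles M /\ a \in T]) elt T.

(* An edge is handled through its ordered pair of endpoints (a, b); both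
   orderings occur. *)
Definition is_edge (a b : vertex M) : Prop :=
  a != b /\ exists2 T, T \in triangles M & ([set a; b]%SET \subset T).

Definition boundary_edge (Omega : set 'rV[R]_2) (a b : vertex M) : Prop :=
  is_edge a b /\ elt [set a; b]%SET `<=` frontier Omega.

Definition interior_edge (Omega : set 'rV[R]_2) (a b : vertex M) : Prop :=
  is_edge a b /\ ~ (elt [set a; b]%SET `<=` frontier Omega).

Definition boundary_vertex (Omega : set 'rV[R]_2) (a : vertex M) : Prop :=
  frontier Omega (pos a).

(* Arc length integral over the edge with endpoints a and b. *)
Definition int_edge (a b : vertex M) (f : 'rV[R]_2 -> R) : R :=
  enorm (pos b - pos a) *
  \int[lebesgue_measure]_(t in `[0, 1]) f ((1 - t) *: pos a + t *: pos b).

Definition edge_normal (a b : vertex M) : 'rV[R]_2 :=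
  let d := pos b - pos a in
  (enorm d)^-1 *: \row_(j < 2) (if j == 0 then - d 0 1 else d 0 0).

Definition dnormal (a b : vertex M) (f : 'rV[R]_2 -> R) : 'rV[R]_2 -> R :=
  fun x => 'D_(edge_normal a b) f x.

End Mesh.

(* Real polynomials in two variables of total degree at most k, as families of
   coefficients; monomial (i, j) stands for x^i y^j. *)
Definition monomial (k : nat) := {m : 'I_k.+1 * 'I_k.+1 | (m.1 + m.2 <= k)%N}.

Definition poly2 (R : realType) (k : nat) := {ffun monomial k -> R^o}.

Definition peval (R : realType) (k : nat) (p : poly2 R k)
    (x : 'rV[R]_2) : R :=
  \sum_m (p m : R) * x 0 0 ^+ (val m).1 * x 0 1 ^+ (val m).2.

Definition triangle (R : realType) (M : mesh R) := {T | T \in triangles M}.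

(* Piecewise cubics. The triangles have nonempty interior and overlap in null
   sets, so an element of L^2(Omega) that is a cubic on each triangle amounts to
   the family of these cubics. *)
Definition P3h (R : realType) (M : mesh R) := {ffun triangle M -> poly2 R 3}.

Section Spaces.
Context {R : realType} (M : mesh R) (Omega : set 'rV[R]_2).
Implicit Types (v : P3h M) (T : triangle M) (a b : vertex M).

Definition restr v T : 'rV[R]_2 -> R := peval (v T).

Definition jump (f : triangle M -> 'rV[R]_2 -> R) T T' : 'rV[R]_2 -> R :=
  fun x => f T x - f T' x.

(* The restrictions to an edge e of the affine functions q of the plane are
   exactly the elements of P_1(e). The sign of the jump is immaterial, and for
   T = T' the conditions are void. *)
Definition B3h v : Prop :=
  (forall a T T', a \in val T -> a \in val T' ->
     restr v T (pos a) = restr v T' (pos a)) /\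
  (forall a b, interior_edge Omega a b ->
     forall T T', [set a; b]%SET \subset val T -> [set a; b]%SET \subset val T' ->
       int_edge a b (jump (restr v) T T') = 0 /\
       forall q : poly2 R 1,
         int_edge a b (fun x =>
           peval q x * jump (fun K => dnormal a b (restr v K)) T T' x) = 0).

Definition B3h0 v : Prop :=
  [/\ B3h v,
      forall a T, boundary_vertex Omega a -> a \in val T ->
        restr v T (pos a) = 0
    & forall a b, boundary_edge Omega a b ->
      forall T, [set a; b]%SET \subset val T ->
        int_edge a b (restr v T) = 0 /\
        forall q : poly2 R 1,
          int_edge a b (fun x => peval q x * dnormal a b (restr v T) x) = 0].

(* v vanishes on Omega outside A. *)
Definition supported_in v (A : set 'rV[R]_2) : Prop :=
  forall T x, elt (val T) x -> ~ A x -> restr v T x = 0.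

End Spaces.

(* Main.v *)
From HB Require Import structures.
Require Import Defs.
From mathcomp Require Import all_boot all_order all_algebra.
From mathcomp Require Import all_classical all_reals all_analysis.
From mathcomp Require Import ring lra.
Import numFieldNormedType.Exports.
Import Order.TTheory GRing.Theory Num.Theory.

(** Let v be a piecewise cubic. By Simpson's rule, which is exact on cubics,
    the edge conditions that define the space B^3_h0 become conditions on point
    values ([edge_condP]): if p is the jump of v across the edge ab and vanishes
    at a and b, they say that
      grad p (a) = grad p (b)
    and that the normal component of grad p (a) + grad p (b) + 4 grad p (m) is 0,
    where m is the midpoint. The first condition says that the difference
    grad v (b) - grad v (a), computed in a triangle containing a and b, does not
    depend on the triangle. So these differences form a 1-cochain d with values in
    the plane. It is closed, as its sum round each triangle is 0, and it vanishes
    on the boundary edges.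

    As the domain Omega is simply connected, d is the coboundary of a function g
    on the vertices that vanishes on the boundary ([cochain_exact]). Therefore v
    is described by three kinds of free parameters: the values v(a) at interior
    vertices, the vectors g(a) at interior vertices, and one normal flux per
    interior edge. Conversely, on a triangle T with vertices a, b, c the data
      v(a), v(b), v(c),   g(b) - g(a), g(c) - g(a),   three normal fluxes
    are 3 + 4 + 3 = 10 numbers, and they determine one cubic ([unisolvent],
    [agree_exists]). A parameter attached to a vertex a only matters on the
    triangles at a, and one attached to an edge ab only on the triangles
    containing this edge. So the functions dual to the parameters are
    supported in vertex patches; they span the space, and a basis is extracted
    from them.

    The exactness of d is where the topology enters. Extended by 0 outside Omega,
    d defines a closed piecewise constant form on the plane: it is locally the
    differential of a piecewise affine function. The plane being simply connected,
    this form has a primitive G ([simply_connected_primitive]), which is locally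
    constant on the complement of Omega. There remains to see that G takes a single
    value on this complement ([compl_const]). Suppose that it takes two, let C be
    the part of the complement where G has its value near infinity, and let p be
    a point of the complement outside C. Counting signed crossings of a ray
    issued from p gives a closed form on the plane minus p, which has a
    primitive N on Omega. Replacing this form by the differential of N off C
    yields a closed form on the whole plane which is unchanged far away. So it has
    a primitive there, but once round a large square containing p the primitive increases
    by 1, a contradiction.

    Closed forms enter only through their germs: a germ at x is a function k x,
    considered near x up to a constant, and nothing more is asked of k x, not even
    continuity. *)

Set Implicit Arguments.
Unset Strict Implicit.
Unset Printing Implicit Defensive.

Local Open Scope classical_set_scope.
Local Open Scope ring_scope.

(** * Germs of closed forms and their primitives *)

Section Germs.
Context {R : realType}.

(** A closed form on A given by local primitives: k x is a primitive near x, and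
    for y near x the functions k x and k y differ by a constant near y. No
    continuity is required of k x. *)
Definition closed_germs (U : topologicalType) (A : set U) (k : U -> U -> R) :=
  forall x, A x -> \forall y \near x, \forall z \near y,
    k x z - k x y = k y z - k y y.

(** F is a primitive of k on A: relatively to A, F - k x is locally constant at
    each point x of A. *)
Definition primitive (U : topologicalType) (A : set U) (k : U -> U -> R)
    (F : U -> R) :=
  forall x, A x -> \forall y \near x, A y -> F y - F x = k x y - k x x.

Lemma primitiveS (U : topologicalType) (A B : set U) k (F : U -> R) :
  A `<=` B -> primitive B k F -> primitive A k F.
Proof.
move=> AB h x Ax; move: (h x (AB _ Ax)); apply: filterS => y hy Ay.
exact/hy/AB.
Qed.

Lemma closed_germs_comp (U V : topologicalType) (A : set V) (f : U -> V) k :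
  continuous f -> (forall x, A (f x)) -> closed_germs A k ->
  closed_germs [set: U] (fun x y => k (f x) (f y)).
Proof.
move=> cf Af kA x _; have := kA _ (Af x).
move=> /cf; rewrite nbhs_filterE /=; apply: filterS => y /=.
by move=> /cf; rewrite nbhs_filterE.
Qed.

(** A property of intervals that holds on all small intervals and passes to
    unions of adjacent intervals holds on the interval from a to b. *)
Lemma interval_ind (a b : R) (P : R -> R -> Prop) :
  a <= b ->
  (forall x y z, x <= y -> y <= z -> P x y -> P y z -> P x z) ->
  (forall x, a <= x <= b -> exists2 e, 0 < e & forall u v,
     a <= u -> u <= v -> v <= b -> x - e <= u -> v <= x + e -> P u v) ->
  P a b.
Proof.
move=> ab glue loc.
pose S := [set t | a <= t <= b /\ P a t].
have Sa : S a.
  split; first by rewrite lexx.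
  have [|e e0] := loc a; first by rewrite lexx.
  by apply; rewrite ?lexx //; lra.
have hS : has_sup S by split; [exists a | exists b => t [/andP[]]].
have sab : a <= sup S <= b.
  apply/andP; split; first exact: (ub_le_sup hS.2).
  by apply: ge_sup; [exists a | move=> t [/andP[]]].
have [e e0 he] := loc _ sab.
have [t [/andP[at_ tb] Pt] ts] := sup_adherent e0 hS.
have tS : t <= sup S by apply: (ub_le_sup hS.2); split=> //; apply/andP.
pose w := Num.min b (sup S + e).
have Pw : S w.
  have sw : sup S <= w by rewrite /w le_min; move: sab; lra.
  have tw := le_trans tS sw.
  split; first by rewrite (le_trans at_ tw) ge_min lexx.
  apply: (glue _ t) => //; apply: he => //.
  - by rewrite ge_min lexx.
  - exact: ltW.
  - by rewrite ge_min lexx orbT.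
have : w <= sup S by apply: (ub_le_sup hS.2).
rewrite /w ge_min => /orP[bs|]; last by lra.
have wb : w = b by apply/min_idPl; lra.
by rewrite -wb; case: Pw.
Qed.

(** S is convex: it contains the segment joining any two of its points. *)
Definition segment_closed (V : lmodType R) (S : set V) :=
  forall x y, S x -> S y -> forall t : R, 0 <= t <= 1 -> S (x + t *: (y - x)).

Lemma segment_continuous (V : normedModType R) (x y : V) :
  continuous (fun t : R => x + t *: (y - x)).
Proof.
move=> t; apply: cvgD; first exact: cvg_cst.
by apply: cvgZ; [exact: cvg_id|exact: cvg_cst].
Qed.

Lemma locally_const_itv (f : R -> R) (a b : R) : a <= b ->
  (forall x, a <= x <= b -> \forall y \near x, a <= y <= b -> f y = f x) ->
  f a = f b.
Proof.
move=> ab hf.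
apply: (@interval_ind a b (fun u v => f u = f v)) => //.
  by move=> x y z _ _ -> ->.
move=> x axb; have := hf _ axb => /nbhs_ballP[e /= e0 he].
exists (e / 2); first by rewrite divr_gt0.
move=> u v au uv vb xu vx.
have hx w : a <= w -> w <= b -> x - e / 2 <= w -> w <= x + e / 2 -> f w = f x.
  move=> aw wb xw wx; apply: he; last by rewrite aw.
  by rewrite /ball /= ltr_norml; lra.
by rewrite !hx //; lra.
Qed.

Lemma locally_const_convex (V : normedModType R) (S : set V) (f : V -> R) :
  segment_closed S -> (forall x, S x -> \forall y \near x, S y -> f y = f x) ->
  forall x y, S x -> S y -> f x = f y.
Proof.
move=> cS hf x y Sx Sy.
have := @locally_const_itv (fun t => f (x + t *: (y - x))) 0 1 ler01.
rewrite scale0r addr0 scale1r subrKC; apply.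
move=> t t01; have := hf _ (cS _ _ Sx Sy _ t01).
move=> /(@segment_continuous _ x y t); rewrite nbhs_filterE /=.
by apply: filterS => s hs s01; apply/hs/cS.
Qed.

Lemma primitive_unique (V : normedModType R) (S : set V) k (F G : V -> R) :
  segment_closed S -> primitive S k F -> primitive S k G ->
  forall x y, S x -> S y -> F y - F x = G y - G x.
Proof.
move=> cS hF hG x y Sx Sy.
have := @locally_const_convex V S (fun z => F z - G z) cS.
suff h z : S z -> \forall w \near z, S w -> F w - G w = F z - G z.
  by move=> /(_ h x y Sx Sy); lra.
move=> Sz; have := hF _ Sz; have := hG _ Sz; apply: filterS2 => w hGw hFw Sw.
by have := hGw Sw; have := hFw Sw; lra.
Qed.

(** Primitives on two closed convex sets that meet can be glued, for on the convex
    intersection they differ by a constant. *)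
Lemma primitive_setU (V : normedModType R) (A B : set V) k (F G : V -> R) z :
  closed A -> closed B -> segment_closed A -> segment_closed B -> A z -> B z ->
  primitive A k F -> primitive B k G ->
  exists H, primitive (A `|` B) k H.
Proof.
move=> clA clB cA cB Az Bz hF hG.
have key x : A x -> B x -> F x - F z = G x - G z.
  move=> Ax Bx; apply: (@primitive_unique _ (A `&` B) k) => //.
  - by move=> u v [Au Bu] [Av Bv] t t01; split; [exact: cA|exact: cB].
  - by apply: primitiveS hF => u [].
  - by apply: primitiveS hG => u [].
exists (fun x => if x \in A then F x else G x - G z + F z) => x ABx.
have nearC (C : set V) : closed C -> ~ C x -> \forall y \near x, ~ C y.
  move=> clC nCx; have /closed_openC oC := clC.
  by have := open_nbhs_nbhs (conj oC nCx).
have [Ax|nAx] := pselect (A x); have [Bx|nBx] := pselect (B x).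
- have := hF _ Ax; have := hG _ Bx; apply: filterS2 => y hGy hFy ABy.
  rewrite (mem_set Ax); have [Ay|nAy] := pselect (A y).
    by rewrite (mem_set Ay) hFy.
  rewrite (memNset nAy); case: ABy => // By.
  by have := key _ Ax Bx; have := hGy By; lra.
- have := hF _ Ax; have := nearC _ clB nBx; apply: filterS2 => y nBy hFy [Ay|//].
  by rewrite (mem_set Ax) (mem_set Ay) hFy.
- have := hG _ Bx; have := nearC _ clA nAx; apply: filterS2 => y nAy hGy [//|By].
  by rewrite (memNset nAx) (memNset nAy); have := hGy By; lra.
- by case: ABx.
Qed.

(** The points whose coordinates lie between a and b, and between c and d. *)
Definition rect (a b c d : R) : set 'rV[R]_2 :=
  [set w | a <= w 0 0 <= b /\ c <= w 0 1 <= d].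

Lemma rect_convex a b c d : segment_closed (rect a b c d).
Proof.
move=> x y [/andP[? ?] /andP[? ?]] [/andP[? ?] /andP[? ?]] t /andP[? ?].
rewrite /rect /= !mxE; split; apply/andP; split; nra.
Qed.

Lemma coord_cts (j : 'I_2) : continuous (fun w : 'rV[R]_2 => w 0 j).
Proof. exact: coord_continuous. Qed.

Lemma rect_closed a b c d : closed (rect a b c d).
Proof.
have -> : rect a b c d = ((fun w : 'rV[R]_2 => w 0 0) @^-1` `[a, b]%classic) `&`
  ((fun w : 'rV[R]_2 => w 0 1) @^-1` `[c, d]%classic).
  by apply/seteqP; split => w /=; rewrite /rect /= !in_itv.
by apply: closedI; apply: preimage_closed => [w _|];
  [exact: coord_cts|exact: itv_closed|exact: coord_cts|exact: itv_closed].
Qed.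

Lemma ord2P (j : 'I_2) : j = 0 \/ j = 1.
Proof. by case: j => [[|[|//]] p]; [left|right]; exact: val_inj. Qed.

Lemma rV2P (x y : 'rV[R]_2) : x 0 0 = y 0 0 -> x 0 1 = y 0 1 -> x = y.
Proof.
by move=> h0 h1; apply/rowP => j; case: (ord2P j) => ->.
Qed.

(** The point of the plane with coordinates s and t. *)
Definition pt (s t : R) : 'rV[R]_2 := \row_(j < 2) if j == 0 then s else t.

Lemma pt0 s t : pt s t 0 0 = s. Proof. by rewrite mxE. Qed.
Lemma pt1 s t : pt s t 0 1 = t. Proof. by rewrite mxE. Qed.

Lemma ball_rV2 (x y : 'rV[R]_2) e : 0 < e ->
  `|x 0 0 - y 0 0| < e -> `|x 0 1 - y 0 1| < e -> ball x e y.
Proof.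
move=> e0 h0 h1; rewrite mx_norm_ball /= /ball_ /=.
rewrite [`|_|]mx_normrE; apply/bigmax_ltP; split => //= -[i j] _ /=.
rewrite (ord1 i) !mxE.
by case: (ord2P j) => ->.
Qed.

(** Glue in the first coordinate to get a primitive on a thin strip, then in the
    second. *)
Lemma rect_primitive (k : 'rV[R]_2 -> 'rV[R]_2 -> R) a b c d :
  a <= b -> c <= d -> closed_germs setT k ->
  exists F, primitive (rect a b c d) k F.
Proof.
move=> ab cd hk.
apply: (@interval_ind c d (fun u v => exists F, primitive (rect a b u v) k F)) => //.
  move=> x y z xy yz [F hF] [G hG].
  have [] := @primitive_setU _ _ _ k F G (pt a y) (@rect_closed a b x y)
    (@rect_closed a b y z) (@rect_convex _ _ _ _) (@rect_convex _ _ _ _) _ _ hF hG.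
  - by rewrite /rect /= pt0 pt1 ab xy !lexx.
  - by rewrite /rect /= pt0 pt1 ab yz !lexx.
  move=> H hH; exists H; apply: primitiveS hH => w [h0 /andP[h1 h2]].
  by have [h|h] := leP (w 0 1) y; [left|right]; split => //; rewrite ?h1 ?h ?h2 ?ltW.
move=> t tcd.
suff [e e0 [F hF]] : exists2 e, 0 < e & exists F, primitive (rect a b (t - e) (t + e)) k F.
  exists e => // u v cu uv vd tu vt; exists F; apply: primitiveS hF => w [h0 /andP[h1 h2]].
  by split=> //; lra.
apply: (@interval_ind a b (fun u v => exists2 e, 0 < e &
  exists F, primitive (rect u v (t - e) (t + e)) k F)) => //.
  move=> x y z xy yz [e e0 [F hF]] [e' e0' [G hG]].
  pose m := Num.min e e'.
  have m0 : 0 < m by rewrite lt_min e0.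
  have me : m <= e by rewrite ge_min lexx.
  have me' : m <= e' by rewrite ge_min lexx orbT.
  exists m => //.
  have hF' : primitive (rect x y (t - m) (t + m)) k F.
    by apply: primitiveS hF => w [h0 /andP[h1 h2]]; split=> //; lra.
  have hG' : primitive (rect y z (t - m) (t + m)) k G.
    by apply: primitiveS hG => w [h0 /andP[h1 h2]]; split=> //; lra.
  have [] := @primitive_setU _ _ _ k F G (pt y t) (@rect_closed _ _ _ _)
    (@rect_closed _ _ _ _) (@rect_convex _ _ _ _) (@rect_convex _ _ _ _) _ _ hF' hG'.
  - by rewrite /rect /= pt0 pt1; lra.
  - by rewrite /rect /= pt0 pt1; lra.
  move=> H hH; exists H; apply: primitiveS hH => w [/andP[h1 h2] h0].
  by have [h|h] := leP (w 0 0) y; [left|right]; split => //; rewrite ?h1 ?h ?h2 ?ltW.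
move=> s sab.
have := hk (pt s t) I => /nbhs_ballP[e /= e0 he].
exists (e / 2); first by rewrite divr_gt0.
move=> u v au uv vb su vs; exists (e / 2); first by rewrite divr_gt0.
exists (k (pt s t)) => x [/andP[? ?] /andP[? ?]].
have : ball (pt s t) e x.
  by apply: ball_rV2 => //; rewrite ?pt0 ?pt1 ltr_norml; lra.
by move=> /he; apply: filterS => y + _.
Qed.

End Germs.

Section Lift.
Context {R : realType}.

Lemma pt_continuous (U : topologicalType) (f g : U -> R) :
  continuous f -> continuous g -> continuous (fun x => pt (f x) (g x)).
Proof.
move=> cf cg x; apply/cvgrPdist_lt => e e0.
have /cvgrPdist_lt /(_ e e0) hf := cf x.
have /cvgrPdist_lt /(_ e e0) hg := cg x.
apply: filterS2 hf hg => y hf hg.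
have := @ball_rV2 R (pt (f x) (g x)) (pt (f y) (g y)) e e0.
rewrite !pt0 !pt1 => /(_ hf hg).
by rewrite mx_norm_ball.
Qed.

Definition unit_itv : set R := [set t | 0 <= t <= 1].

Lemma unit_itv_convex : segment_closed (unit_itv : set R^o).
Proof.
move=> x y /andP[? ?] /andP[? ?] t /andP[? ?].
by apply/andP; rewrite /GRing.scale /=; split; nra.
Qed.

Lemma unit_itv0 : unit_itv 0. Proof. by rewrite /unit_itv /= lexx ler01. Qed.
Lemma unit_itv1 : unit_itv 1. Proof. by rewrite /unit_itv /= lexx ler01. Qed.

Section Path.
Context (V : topologicalType) (A : set V) (k : V -> V -> R).
Hypothesis hk : closed_germs A k.

Lemma path_primitive (g : R -> V) : continuous g -> (forall t, A (g t)) ->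
  exists F, primitive unit_itv (fun s t => k (g s) (g t)) F.
Proof.
move=> cg Ag.
have cg' : continuous (fun w : 'rV[R]_2 => g (w 0 0)).
  by move=> w; apply: continuous_comp; [exact: coord_cts|exact: cg].
have := closed_germs_comp cg' (fun w => Ag (w 0 0)) hk.
move=> /(@rect_primitive _ _ 0 1 0 0 ler01 (lexx 0))[F hF].
exists (fun t => F (pt t 0)) => s s01.
have : rect 0 1 0 0 (pt s 0) by rewrite /rect /= pt0 pt1 lexx; split.
move=> /hF.
have cpt : continuous (fun t : R => pt t 0).
  by apply: pt_continuous => t; [exact: cvg_id|exact: cvg_cst].
move=> /(cpt s); rewrite nbhs_filterE /=; apply: filterS => t.
move=> /= + t01; rewrite !pt0; apply.
by rewrite /rect /= pt0 pt1 lexx; split.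
Qed.

(** The integral of a closed form along h is its integral along any path through
    which h factors: the change of parameter a need not be monotone. *)
Lemma reparam_primitive (g h : R -> V) (F H : R -> R) (a : R -> R) :
  continuous a -> (forall t, unit_itv t -> unit_itv (a t)) ->
  (forall t, unit_itv t -> g (a t) = h t) ->
  primitive unit_itv (fun s t => k (g s) (g t)) F ->
  primitive unit_itv (fun s t => k (h s) (h t)) H ->
  F (a 1) - F (a 0) = H 1 - H 0.
Proof.
move=> ca a01 agh hF hH.
apply: (@primitive_unique R R^o unit_itv (fun s t => k (h s) (h t)) (F \o a) H);
  [exact: unit_itv_convex| |exact: hH|exact: unit_itv0|exact: unit_itv1].
move=> s s01; have := hF _ (a01 _ s01).
move=> /(ca s); rewrite nbhs_filterE /=; apply: filterS => t /= h1 t01.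
by rewrite h1 ?agh //; exact: a01.
Qed.

Lemma const_primitive (g : R -> V) (F : R -> R) :
  (forall t, unit_itv t -> g t = g 0) ->
  primitive unit_itv (fun s t => k (g s) (g t)) F -> F 1 = F 0.
Proof.
move=> g0 hF.
have h0 : primitive unit_itv (fun s t => k (g s) (g t)) (fun=> 0).
  move=> s s01; apply: (@filterE _ _ (nbhs_filter s)) => t t01.
  by rewrite (g0 _ s01) (g0 _ t01) !subrr.
have := @primitive_unique R R^o _ _ _ _ unit_itv_convex hF h0 _ _ unit_itv0 unit_itv1.
by move=> /eqP; rewrite subrr subr_eq0 => /eqP.
Qed.

(** H is a homotopy of the loop H (0, .) to a point. A primitive on the square is
    constant on the three sides other than this loop, hence also increases by 0
    along it. *)
Lemma loop_primitive (H : 'rV[R]_2 -> V) (F : R -> R) :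
  continuous H -> (forall w, A (H w)) ->
  (forall t, unit_itv t -> H (pt 1 t) = H (pt 0 0)) ->
  (forall s, unit_itv s -> H (pt s 0) = H (pt 0 0)) ->
  (forall s, unit_itv s -> H (pt s 1) = H (pt 0 0)) ->
  primitive unit_itv (fun s t => k (H (pt 0 s)) (H (pt 0 t))) F -> F 1 = F 0.
Proof.
move=> cH AH H1 Hs0 Hs1 hF.
have := closed_germs_comp cH AH hk.
move=> /(@rect_primitive _ _ 0 1 0 1 ler01 ler01)[G hG].
have sub (p : R -> 'rV[R]_2) : continuous p ->
    (forall t, unit_itv t -> rect 0 1 0 1 (p t)) ->
    primitive unit_itv (fun s t => k (H (p s)) (H (p t))) (G \o p).
  move=> cp rp s s01; have := hG _ (rp _ s01).
  move=> /(cp s); rewrite nbhs_filterE /=; apply: filterS => t /= h1 t01.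
  by rewrite h1 //; exact: rp.
have r01 s t : unit_itv s -> unit_itv t -> rect 0 1 0 1 (pt s t).
  by move=> ? ?; rewrite /rect /= pt0 pt1.
have i0 := unit_itv0; have i1 := unit_itv1.
have cst (x : R) : continuous (fun _ : R => x) by move=> t; exact: cvg_cst.
have cid : continuous (fun t : R => t) by move=> t; exact: cvg_id.
have e1 : G (pt 1 1) = G (pt 1 0).
  apply: (@const_primitive (fun t => H (pt 1 t)) (fun t => G (pt 1 t))).
    by move=> t t01; rewrite !H1.
  by apply: (sub (fun t => pt 1 t)); [exact: pt_continuous|move=> t t01; exact: r01].
have e2 : G (pt 1 0) = G (pt 0 0).
  apply: (@const_primitive (fun t => H (pt t 0)) (fun t => G (pt t 0))).
    by move=> t t01; rewrite !Hs0.
  by apply: (sub (fun t => pt t 0)); [exact: pt_continuous|move=> t t01; exact: r01].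
have e3 : G (pt 1 1) = G (pt 0 1).
  apply: (@const_primitive (fun t => H (pt t 1)) (fun t => G (pt t 1))).
    by move=> t t01; rewrite !Hs1.
  by apply: (sub (fun t => pt t 1)); [exact: pt_continuous|move=> t t01; exact: r01].
have h0 := sub (fun t => pt 0 t) (pt_continuous (cst 0) cid)
  (fun t t01 => r01 _ _ i0 t01).
have := @primitive_unique R R^o _ _ _ _ unit_itv_convex hF h0 _ _ i0 i1.
rewrite /= -e3 e1 e2; lra.
Qed.

End Path.

(** The retraction of the line onto the unit interval; it turns a path or a
    homotopy defined on the unit interval into one defined everywhere. *)
Definition clamp (t : R) : R := Num.max 0 (Num.min 1 t).

Lemma clamp_continuous : continuous clamp.
Proof.
move=> t; apply: continuous_max; first exact: cvg_cst.
by apply: continuous_min; [exact: cvg_cst|exact: cvg_id].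
Qed.

Lemma clamp_itv t : unit_itv (clamp t).
Proof.
rewrite /unit_itv /clamp /= le_max lexx /= ge_max ler01 /=.
by rewrite ge_min lexx.
Qed.

Lemma clamp_id t : unit_itv t -> clamp t = t.
Proof.
by move=> /andP[t0 t1]; rewrite /clamp min_r // max_r.
Qed.

Lemma clamp_le0 t : t <= 0 -> clamp t = 0.
Proof. by move=> t0; rewrite /clamp max_l // ge_min t0 orbT. Qed.

Lemma clamp_ge1 t : 1 <= t -> clamp t = 1.
Proof. by move=> t1; rewrite /clamp min_l // max_r. Qed.

Lemma within_comp (U V W : topologicalType) (A : set V) (f : V -> W) (c : U -> V) :
  {within A, continuous f} -> continuous c -> (forall x, A (c x)) ->
  continuous (f \o c).
Proof.
move=> /subspace_continuousP cf cc Ac x; apply: cvg_comp (cf _ (Ac x)).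
move=> B /= hB; have := cc x _ hB.
by rewrite !nbhs_filterE /=; apply: filterS => y; apply; exact: Ac.
Qed.

End Lift.

Section Poincare.
Context {R : realType}.
Local Notation plane := 'rV[R]_2.

Lemma eq_primitive (U : topologicalType) (A : set U) (k k' : U -> U -> R) F :
  (forall x y, A x -> A y -> k x y = k' x y) ->
  primitive A k F -> primitive A k' F.
Proof.
move=> kk' hF x Ax; apply: filterS (hF _ Ax) => y h Ay.
by rewrite h // !kk'.
Qed.

Lemma unit_itvE (t : R) : unit_itv t -> t \in `[0, 1].
Proof. by rewrite in_itv. Qed.

Lemma null_loop (X : set plane) (k : plane -> plane -> R) (g : R -> plane) F :
  simply_connected X -> closed_germs X k ->
  continuous g -> (forall t, X (g t)) -> g 0 = g 1 ->
  primitive unit_itv (fun s t => k (g s) (g t)) F -> F 1 = F 0.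
Proof.
move=> [_ scX] hk cg Xg g01 hF.
have [] := scX g _ _ g01.
- exact: continuous_subspaceT.
- by move=> _ [t _ <-].
move=> H [cH XH H0 H1 Hs].
pose c (w : plane) : R * R := (clamp (w 0 0), clamp (w 0 1)).
have cc : continuous c.
  move=> w; apply: (@cvg_pair _ _ _ (nbhs w) (nbhs (c w).1) (nbhs (c w).2)).
    exact: (cvg_comp _ _ (@coord_cts R 0 w) (@clamp_continuous R (w 0 0))).
  exact: (cvg_comp _ _ (@coord_cts R 1 w) (@clamp_continuous R (w 0 1))).
have c01 w : (`[0, 1]%classic `*` `[0, 1]%classic) (c w).
  by split; rewrite /= in_itv; exact: clamp_itv.
have i0 := @unit_itv0 R; have i1 := @unit_itv1 R.
have cpt s t : unit_itv s -> unit_itv t -> c (pt s t) = (s, t).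
  by move=> s01 t01; rewrite /c pt0 pt1 !clamp_id.
apply: (@loop_primitive R _ X k hk (H \o c) F).
- exact: within_comp cH cc c01.
- by move=> w; apply: XH; exists (c w).
- by move=> t t01 /=; rewrite !cpt // H1 ?H0 //; exact: unit_itvE.
- move=> s s01 /=; rewrite !cpt // (Hs _ (unit_itvE s01)).1 H0 //.
- move=> s s01 /=; rewrite !cpt // (Hs _ (unit_itvE s01)).2 H0 //.
apply: eq_primitive hF => s t s01 t01 /=.
by rewrite !cpt // !H0 //; exact: unit_itvE.
Qed.

Lemma path_exists (X : set plane) x y : simply_connected X -> X x -> X y ->
  exists g : R -> plane,
    [/\ continuous g, forall t, X (g t), g 0 = x & g 1 = y].
Proof.
move=> [scX _] Xx Xy; have [g [cg gX g0 g1]] := scX _ _ Xx Xy.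
exists (g \o clamp); split => /=.
- by apply: within_comp cg clamp_continuous _ => t; rewrite /= in_itv; exact: clamp_itv.
- by move=> t; apply: gX; exists (clamp t) => //; rewrite /= in_itv; exact: clamp_itv.
- by rewrite clamp_id //; exact: unit_itv0.
- by rewrite clamp_id //; exact: unit_itv1.
Qed.

(** The integrals of a closed form along the sides of a curved triangle: the
    paths g1 (from A to B), g2 (from B to C) and g3 (from A to C) form a loop. *)
Lemma triangle_loop (X : set plane) (k : plane -> plane -> R)
    (g1 g2 g3 : R -> plane) (F1 F2 F3 : R -> R) :
  simply_connected X -> closed_germs X k ->
  continuous g1 -> continuous g2 -> continuous g3 ->
  (forall t, unit_itv t -> X (g1 t)) -> (forall t, unit_itv t -> X (g2 t)) ->
  (forall t, unit_itv t -> X (g3 t)) ->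
  g1 0 = g3 0 -> g1 1 = g2 0 -> g2 1 = g3 1 ->
  primitive unit_itv (fun s t => k (g1 s) (g1 t)) F1 ->
  primitive unit_itv (fun s t => k (g2 s) (g2 t)) F2 ->
  primitive unit_itv (fun s t => k (g3 s) (g3 t)) F3 ->
  F1 1 - F1 0 + (F2 1 - F2 0) = F3 1 - F3 0.
Proof.
move=> scX hk c1 c2 c3 X1 X2 X3 e1 e2 e3 p1 p2 p3.
(* The concatenation of g1, g2 and g3 reversed, written as a sum so that
   its continuity is immediate: on each third of the unit interval two of the
   three terms are constant. *)
pose g t := g1 (clamp (3 * t)) + (g2 (clamp (3 * t - 1)) - g2 0)
  + (g3 (clamp (3 - 3 * t)) - g3 1).
have gE1 t : t <= 3^-1 -> g t = g1 (clamp (3 * t)).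
  move=> t3; rewrite /g (clamp_le0 (_ : 3 * t - 1 <= 0)); last by lra.
  by rewrite (clamp_ge1 (_ : 1 <= 3 - 3 * t)) ?subrr ?addr0 //; lra.
have gE2 t : 3^-1 <= t <= 2 / 3 -> g t = g2 (clamp (3 * t - 1)).
  move=> /andP[t3 t3']; rewrite /g (clamp_ge1 (_ : 1 <= 3 * t)); last by lra.
  rewrite (clamp_ge1 (_ : 1 <= 3 - 3 * t)) ?subrr ?addr0 //; last by lra.
  by rewrite e2 addrC subrK.
have gE3 t : 2 / 3 <= t -> g t = g3 (clamp (3 - 3 * t)).
  move=> t3; rewrite /g (clamp_ge1 (_ : 1 <= 3 * t)); last by lra.
  rewrite (clamp_ge1 (_ : 1 <= 3 * t - 1)); last by lra.
  by rewrite e2 (addrC (g2 0)) subrK e3 addrC subrK.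
have lin (a b : R) : continuous (fun t : R => a * t + b).
  move=> t; apply: cvgD; last exact: cvg_cst.
  by apply: cvgM; [exact: cvg_cst|exact: cvg_id].
have cl (h : R -> plane) (a b : R) (u : R -> R) : u =1 (fun t => a * t + b) ->
    continuous h -> continuous (fun t => h (clamp (u t))).
  move=> /funext -> ch t.
  apply: (@continuous_comp _ _ _ (fun t => clamp (a * t + b)) h); last exact: ch.
  by apply: (@continuous_comp _ _ _ (fun t => a * t + b) clamp);
    [exact: lin|exact: clamp_continuous].
have cg : continuous g.
  move=> t; apply: cvgD; [apply: cvgD|].
  - by apply: (cl g1 3 0 (fun t => 3 * t)) => // s; rewrite addr0.
  - apply: cvgB; [|exact: cvg_cst].
    exact: (cl g2 3 (-1) (fun t => 3 * t - 1)).
  - apply: cvgB; [|exact: cvg_cst].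
    by apply: (cl g3 (-3) 3 (fun t => 3 - 3 * t)) => // s; rewrite mulNr addrC.
have Xg t : X (g t).
  have [t3|t3] := leP t 3^-1; first by rewrite gE1 //; apply/X1/clamp_itv.
  have [t3'|t3'] := leP t (2 / 3).
    by rewrite gE2 ?(ltW t3) //; apply/X2/clamp_itv.
  by rewrite gE3 ?(ltW t3') //; apply/X3/clamp_itv.
have i0 := @unit_itv0 R; have i1 := @unit_itv1 R.
have g00 : g 0 = g1 0 by rewrite gE1 ?mulr0 ?clamp_le0 //; lra.
have g01 : g 1 = g3 0 by rewrite gE3 ?mulr1 ?subrr ?clamp_le0 //; lra.
have [F hF] := path_primitive hk cg Xg.
have F10 : F 1 = F 0 by apply: (null_loop scX hk cg Xg _ hF); rewrite g00 g01.
have r1 : F (3^-1 * 1 + 0) - F (3^-1 * 0 + 0) = F1 1 - F1 0.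
  apply: (reparam_primitive (lin _ _) _ _ hF p1) => t /andP[? ?].
    by apply/andP; lra.
  rewrite gE1; last by lra.
  by rewrite addr0 mulrA mulfV ?mul1r ?clamp_id //; apply/andP.
have r2 : F (3^-1 * 1 + 3^-1) - F (3^-1 * 0 + 3^-1) = F2 1 - F2 0.
  apply: (reparam_primitive (lin _ _) _ _ hF p2) => t /andP[? ?].
    by apply/andP; lra.
  rewrite gE2; last by lra.
  have -> : 3 * (3^-1 * t + 3^-1) - 1 = t by field.
  by rewrite clamp_id //; apply/andP.
have r3 : F (- 3^-1 * 1 + 1) - F (- 3^-1 * 0 + 1) = F3 1 - F3 0.
  apply: (reparam_primitive (lin _ _) _ _ hF p3) => t /andP[? ?].
    by apply/andP; lra.
  rewrite gE3; last by lra.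
  have -> : 3 - 3 * (- 3^-1 * t + 1) = t by field.
  by rewrite clamp_id //; apply/andP.
move: r1 r2 r3; rewrite !mulr0 !mulr1 !addr0 !add0r.
have -> : 3^-1 + 3^-1 = - 3^-1 + 1 :> R by field.
lra.
Qed.

(** The Poincare lemma on a simply connected open set. *)
Theorem simply_connected_primitive (X : set plane) (k : plane -> plane -> R) :
  open X -> simply_connected X -> closed_germs X k ->
  exists F, primitive X k F.
Proof.
move=> oX scX hk.
have [[x0 Xx0]|nX] := pselect (X !=set0); last first.
  by exists (fun=> 0) => x Xx; case: nX; exists x.
have : forall x, exists p : (R -> plane) * (R -> R), X x ->
    [/\ continuous p.1, forall t, X (p.1 t), p.1 0 = x0, p.1 1 = x &
        primitive unit_itv (fun s t => k (p.1 s) (p.1 t)) p.2].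
  move=> x; have [Xx|nXx] := pselect (X x); last by exists (fun=> 0, fun=> 0).
  have [g [cg Xg g0 g1]] := path_exists scX Xx0 Xx.
  by have [F hF] := path_primitive hk cg Xg; exists (g, F).
move=> /choice[p hp].
exists (fun x => (p x).2 1 - (p x).2 0) => x Xx.
have := oX; rewrite openE => /(_ x Xx); rewrite /interior /=.
have := hk _ Xx => /nbhs_ballP[e1 /= e10 h1] /nbhs_ballP[e2 /= e20 h2].
pose e := Num.min e1 e2.
have e0 : 0 < e by rewrite lt_min e10.
have eb z : ball x e z -> ball x e1 z /\ ball x e2 z.
  by move=> bz; split; apply: le_ball bz; rewrite ge_min lexx ?orbT.
apply/nbhs_ballP; exists e => //= y xy Xy.
have xx : ball x e x by exact: ballxx.
have seg t : unit_itv t -> ball x e (x + t *: (y - x)).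
  move=> /andP[t0 t1]; move: xy; rewrite mx_norm_ball /ball_ /= => xy.
  rewrite opprD addrA subrr add0r normrN normrZ ger0_norm // distrC.
  by apply: le_lt_trans xy; rewrite ler_piMl.
have [c1 X1 g10 g11 P1] := hp _ Xx.
have [c3 X3 g30 g31 P3] := hp _ Xy.
have c2 := @segment_continuous R _ x y.
have P2 : primitive unit_itv (fun s t => k (x + s *: (y - x)) (x + t *: (y - x)))
    (fun t => k x (x + t *: (y - x))).
  move=> s s01; have := h1 _ (eb _ (seg _ s01)).1.
  move=> /(c2 s); rewrite nbhs_filterE /=; apply: filterS => t /= h t01.
  exact: h.
have := @triangle_loop X k _ _ _ _ _ _ scX hk c1 c2 c3 (fun t _ => X1 t) _
  (fun t _ => X3 t) _ _ _ P1 P2 P3.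
rewrite scale0r scale1r addr0 subrKC g10 g30 g11 g31.
by move=> <- //; [lra|move=> t t01; exact: h2 (eb _ (seg _ t01)).2].
Qed.

Lemma simply_connected_plane : simply_connected [set: plane].
Proof.
split=> [x y _ _|g cg _ g01].
  exists (fun t => x + t *: (y - x)); split => //.
  - exact/continuous_subspaceT/segment_continuous.
  - by rewrite scale0r addr0.
  - by rewrite scale1r subrKC.
pose H (z : R * R) : plane := (1 - z.1) *: (g \o clamp) z.2 + z.1 *: g 0.
have cgc : continuous (g \o clamp).
  apply: within_comp cg clamp_continuous _ => t.
  by rewrite /= in_itv; exact: clamp_itv.
exists H; split => //.
- apply: continuous_subspaceT => z; apply: cvgD; apply: cvgZ.
  + by apply: cvgB; [exact: cvg_cst|exact: cvg_fst].
  + by apply: (@continuous_comp _ _ _ snd (g \o clamp) z); [exact: cvg_snd|exact: cgc].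
  + exact: cvg_fst.
  + exact: cvg_cst.
- move=> t; rewrite in_itv /H /= => t01.
  by rewrite subr0 scale1r scale0r addr0 clamp_id.
- by move=> t _; rewrite /H /= subrr scale0r add0r scale1r.
- move=> s _; rewrite /H /= clamp_le0 // clamp_ge1 // -g01.
  by rewrite -scalerDl subrK scale1r.
Qed.

End Poincare.

(** * The complement of a simply connected domain *)

Section Complement.
Context {R : realType}.
Local Notation plane := 'rV[R]_2.

Lemma near_coord_lt (j : 'I_2) (x : plane) t : x 0 j < t ->
  \forall y \near x, (y : plane) 0 j < t.
Proof. exact: (@cvgr_lt _ _ _ _ (fun y : plane => y 0 j) (x 0 j) (@coord_cts R j x)). Qed.

Lemma near_coord_gt (j : 'I_2) (x : plane) t : t < x 0 j ->
  \forall y \near x, t < (y : plane) 0 j.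
Proof. exact: (@cvgr_gt _ _ _ _ (fun y : plane => y 0 j) (x 0 j) (@coord_cts R j x)). Qed.

(** The germs of the form that counts crossings of the horizontal ray issued from p
    to the right: a path that crosses it upwards gets 1. Off the ray the germ
    is constant. *)
Definition crossing (p x y : plane) : R :=
  if (x 0 1 == p 0 1) && (p 0 0 < x 0 0) then (p 0 1 <= y 0 1)%R%:R else 0.

Lemma crossing_closed (p : plane) : closed_germs [set x | x <> p] (crossing p).
Proof.
move=> x /= xp; rewrite /crossing.
have [/andP[/eqP x1 x0]|xL] := boolP ((x 0 1 == p 0 1) && (p 0 0 < x 0 0)).
  have := near_coord_gt x0; apply: filterS => y y0; rewrite y0 andbT.
  have [y1|y1] := eqVneq (y 0 1) (p 0 1).
    exact: (@filterE _ _ (nbhs_filter y)).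
  have [y1'|y1'] := leP (p 0 1) (y 0 1).
    have := near_coord_gt (_ : p 0 1 < y 0 1).
    rewrite lt_neqAle eq_sym y1 y1' => /(_ isT); apply: filterS => z z1.
    by rewrite (ltW z1) !subrr.
  have := near_coord_lt y1'; apply: filterS => z z1.
  by rewrite leNgt z1 !subrr.
have : \forall y \near x, ~~ (((y : plane) 0 1 == p 0 1) && (p 0 0 < y 0 0)).
  move: xL; rewrite negb_and => /orP[|].
    rewrite neq_lt => /orP[|] h.
      by have := near_coord_lt h; apply: filterS => y y1; rewrite lt_eqF.
    by have := near_coord_gt h; apply: filterS => y y1; rewrite gt_eqF.
  rewrite -leNgt le_eqVlt => /orP[/eqP x0|h].
    have : x 0 1 != p 0 1.
      by apply: contra_notN xp => /eqP x1; exact: rV2P.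
    rewrite neq_lt => /orP[|] h.
      by have := near_coord_lt h; apply: filterS => y y1; rewrite lt_eqF.
    by have := near_coord_gt h; apply: filterS => y y1; rewrite gt_eqF.
  have := near_coord_lt h; apply: filterS => y y0.
  by rewrite negb_and -leNgt (ltW y0) orbT.
apply: filterS => y /negbTE ->.
by apply: (@filterE _ _ (nbhs_filter y)) => z; rewrite !subrr.
Qed.

Lemma halfplane_ge_convex (j : 'I_2) (B : R) :
  segment_closed [set w : plane | B <= w 0 j].
Proof. by move=> x y /= ? ? t /andP[? ?]; rewrite !mxE; nra. Qed.

Lemma halfplane_le_convex (j : 'I_2) (B : R) :
  segment_closed [set w : plane | w 0 j <= B].
Proof. by move=> x y /= ? ? t /andP[? ?]; rewrite !mxE; nra. Qed.

Lemma segment_closedI (V : lmodType R) (A B : set V) :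
  segment_closed A -> segment_closed B -> segment_closed (A `&` B).
Proof. by move=> cA cB x y [? ?] [? ?] t t01; split; [exact: cA|exact: cB]. Qed.

(** The crossing form has no primitive outside a square containing p: along the
    four sides, it would increase by 1. Each side is replaced by the half plane
    beyond it, the right one being cut along the ray. *)
Lemma crossing_contradiction (p : plane) (B : R) (F : plane -> R) :
  `|p 0 0| < B -> `|p 0 1| < B ->
  (forall x : plane, B <= `|x 0 0| \/ B <= `|x 0 1| ->
     \forall y \near x, F y - F x = crossing p x y - crossing p x x) -> False.
Proof.
rewrite !ltr_norml => /andP[p0 p0'] /andP[p1 p1'] hF.
have B0 : 0 < B by lra.
have const (S : set plane) : segment_closed S ->
    (forall x, S x -> (B <= `|x 0 0| \/ B <= `|x 0 1|) /\
        ~~ ((x 0 1 == p 0 1) && (p 0 0 < x 0 0))) ->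
    forall x y, S x -> S y -> F x = F y.
  move=> cS hS x y Sx Sy; apply: (locally_const_convex cS) => // z Sz.
  have [z1 z2] := hS _ Sz; have := hF _ z1; apply: filterS => w + _.
  by rewrite /crossing (negbTE z2) subrr => /eqP; rewrite subr_eq0 => /eqP.
have top : F (pt B B) = F (pt (- B) B).
  apply: (const _ (@halfplane_ge_convex 1 B)) => [x /= x1||];
    rewrite /= ?pt1 //.
  split; first by right; rewrite ler_normr x1.
  by rewrite gt_eqF //; lra.
have left : F (pt (- B) B) = F (pt (- B) (- B)).
  apply: (const _ (@halfplane_le_convex 0 (- B))) => [x /= x0||];
    rewrite /= ?pt0 //.
  split; first by left; rewrite ler_normr; apply/orP; right; lra.
  by rewrite negb_and -leNgt; apply/orP; right; lra.
have bottom : F (pt (- B) (- B)) = F (pt B (- B)).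
  apply: (const _ (@halfplane_le_convex 1 (- B))) => [x /= x1||];
    rewrite /= ?pt1 //.
  split; first by right; rewrite ler_normr; apply/orP; right; lra.
  by rewrite lt_eqF //; lra.
have far0 (x : plane) : B <= x 0 0 -> B <= `|x 0 0| \/ B <= `|x 0 1|.
  by move=> ?; left; rewrite ler_normr; apply/orP; left.
have rtop : F (pt B (p 0 1)) = F (pt B B).
  pose S := [set w : plane | B <= w 0 0] `&` [set w : plane | p 0 1 <= w 0 1].
  have cS : segment_closed S.
    by apply: segment_closedI; [exact: halfplane_ge_convex|exact: halfplane_ge_convex].
  apply: (locally_const_convex cS); rewrite /S /= ?pt0 ?pt1; [|by split|by split=> //; lra].
  move=> x [x0 x1]; have := hF _ (far0 _ x0); apply: filterS => y + [y0 y1].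
  by rewrite /crossing x1 y1; case: ifP => _; rewrite subrr => /eqP;
    rewrite subr_eq0 => /eqP.
have rbot : F (pt B (- B)) + 1 = F (pt B (p 0 1)).
  pose S := [set w : plane | B <= w 0 0] `&` [set w : plane | w 0 1 <= p 0 1].
  have cS : segment_closed S.
    by apply: segment_closedI; [exact: halfplane_ge_convex|exact: halfplane_le_convex].
  have := @locally_const_convex R _ S
    (fun w => F w + (w 0 1 < p 0 1)%R%:R) cS _ (pt B (- B)) (pt B (p 0 1)).
  rewrite /S /= !pt0 !pt1 ltxx addr0 p1; apply; [|by split=> //; lra|by split].
  move=> x [x0 x1]; have hx := hF _ (far0 _ x0).
  have [e|x1'] := eqVneq (x 0 1) (p 0 1).
    move: hx; apply: filterS => y + [y0 y1]; rewrite /crossing e ltxx lexx eqxx.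
    have -> /= : p 0 0 < x 0 0 by lra.
    by rewrite leNgt; case: ltP => _ /=; lra.
  have h : x 0 1 < p 0 1 by rewrite lt_neqAle x1'.
  have := near_coord_lt h; apply: filterS2 hx => y + y1 [y0 _].
  by rewrite /crossing (negbTE x1') h y1 /=; lra.
by move: rbot; rewrite rtop top left bottom; lra.
Qed.

(** By contradiction: on the set C where G has its value at infinity keep the
    crossing form of p, and elsewhere use a primitive N of it on Omega. The
    values of N outside Omega do not matter, as C is relatively open in the
    complement of Omega. *)
Lemma compl_const_far (Omega : set plane) (G : plane -> R) (p : plane) (B : R) :
  open Omega -> simply_connected Omega ->
  (forall x, ~ Omega x -> \forall y \near x, ~ Omega y -> G y = G x) ->
  (forall x, Omega x -> `|x 0 0| < B /\ `|x 0 1| < B) ->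
  ~ Omega p -> `|p 0 0| < B -> `|p 0 1| < B ->
  G p = G (pt B B).
Proof.
move=> oO scO hG OB nOp p0 p1.
have B0 : 0 < B by apply: le_lt_trans p0.
have far (x : plane) : B <= `|x 0 0| \/ B <= `|x 0 1| -> ~ Omega x.
  by move=> h /OB[]; case: h; rewrite leNgt => /negbTE ->.
have const (S : set plane) : segment_closed S ->
    (forall x, S x -> B <= `|x 0 0| \/ B <= `|x 0 1|) ->
    forall x y, S x -> S y -> G x = G y.
  move=> cS hS x y Sx Sy; apply: (locally_const_convex cS) => // z Sz.
  have := hG _ (far _ (hS _ Sz)); apply: filterS => w hw Sw.
  by apply/hw/far/hS.
have top (x : plane) : B <= x 0 1 -> G x = G (pt B B).
  move=> x1; apply: (const _ (@halfplane_ge_convex 1 B)); rewrite /= ?pt1 //.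
  by move=> y y1; right; rewrite ler_normr y1.
have left (x : plane) : x 0 0 <= - B -> G x = G (pt B B).
  move=> x1; transitivity (G (pt (- B) B)); last by apply: top; rewrite pt1.
  apply: (const _ (@halfplane_le_convex 0 (- B))); rewrite /= ?pt0 //.
  by move=> y y1; left; rewrite ler_normr; apply/orP; right; lra.
have right (x : plane) : B <= x 0 0 -> G x = G (pt B B).
  move=> x1; apply: (const _ (@halfplane_ge_convex 0 B)); rewrite /= ?pt0 //.
  by move=> y y1; left; rewrite ler_normr y1.
have bottom (x : plane) : x 0 1 <= - B -> G x = G (pt B B).
  move=> x1; transitivity (G (pt B (- B))); last by apply: right; rewrite pt0.
  apply: (const _ (@halfplane_le_convex 1 (- B))); rewrite /= ?pt1 //.
  by move=> y y1; right; rewrite ler_normr; apply/orP; right; lra.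
have farG (x : plane) : B <= `|x 0 0| \/ B <= `|x 0 1| -> G x = G (pt B B).
  rewrite !ler_normr => -[/orP[|]|/orP[|]] h.
  - exact: right.
  - by apply: left; lra.
  - exact: top.
  - by apply: bottom; lra.
apply: contrapT => nGp.
pose C := [set x | ~ Omega x /\ G x = G (pt B B)].
have nearO x : Omega x -> \forall y \near x, Omega y.
  by move=> Ox; exact: (open_nbhs_nbhs (conj oO Ox)).
have pO : Omega `<=` [set x | x <> p] by move=> x Ox /= e; apply: nOp; rewrite -e.
have pC x : C x -> x <> p by move=> [_ e] xp; apply: nGp; rewrite -xp.
have cO : closed_germs Omega (crossing p).
  by move=> x /pO; exact: crossing_closed.
have [N hN] := simply_connected_primitive oO scO cO.
pose k x y := if `[< C x >] then crossing p x y else N y.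
have kC x y : C x -> k x y = crossing p x y by move=> /asboolP h; rewrite /k h.
have knC x y : ~ C x -> k x y = N y by move=> /asboolPn /negbTE h; rewrite /k h.
have ck : closed_germs setT k.
  move=> x _; have [Cx|nCx] := pselect (C x).
    have [nOx Gx] := Cx.
    have hx := crossing_closed (pC _ Cx).
    have := hG _ nOx; apply: filterS2 hx => y hy Gy.
    have [Oy|nOy] := pselect (Omega y).
      have nCy : ~ C y by case.
      have a1 := nearO _ Oy; have a2 := hN _ Oy; move: a2 a1 hy.  apply: filterS3 => z hz Oz h.
      by rewrite (kC x z) // (kC x y) // !knC // h hz.
    have Cy : C y by split => //; rewrite Gy.
    by move: hy; apply: filterS => z; rewrite !kC.
  have : \forall y \near x, ~ C y.
    have [Ox|nOx] := pselect (Omega x).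
      by apply: filterS (nearO _ Ox) => y Oy [].
    have := hG _ nOx; apply: filterS => y Gy [nOy GyB].
    by apply: nCx; split => //; rewrite -Gy.
  apply: filterS => y nCy; apply: (@filterE _ _ (nbhs_filter y)) => z.
  by rewrite !knC.
have [F hF] := simply_connected_primitive openT simply_connected_plane ck.
apply: (crossing_contradiction p0 p1 (F := F)) => x hx.
have Cx : C x by split; [exact: far|exact: farG].
have := hF x I; apply: filterS => y /(_ I).
by rewrite !kC.
Qed.

(** The complement of a bounded simply connected open set of the plane is
    connected, in the form: a locally constant function on it is constant. *)
Theorem compl_const (Omega : set plane) (G : plane -> R) :
  open Omega -> bounded_set Omega -> simply_connected Omega ->
  (forall x, ~ Omega x -> \forall y \near x, ~ Omega y -> G y = G x) ->
  forall x y, ~ Omega x -> ~ Omega y -> G x = G y.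
Proof.
move=> oO bO scO hG x y nOx nOy.
have [M [_ /(_ (M + 1)) hM]] := bO.
have coord (w : plane) j : `|w 0 j| <= `|w|.
  rewrite [`|w|]mx_normrE.
  exact: (le_bigmax _ (fun ij : 'I_1 * 'I_2 => `|w ij.1 ij.2|) (0, j)).
pose B := `|M| + `|x| + `|y| + 2.
have aux (m m' a b n v : R) : v <= n -> n <= m + 1 -> m <= m' -> 0 <= a ->
    0 <= b -> v < m' + a + b + 2 by lra.
have BO w : Omega w -> `|w 0 0| < B /\ `|w 0 1| < B.
  move=> Ow; have := hM _ w Ow; rewrite ltrDl ltr01 => /(_ isT) wM.
  by split; apply: (aux M _ _ _ `|w|); rewrite ?normr_ge0 // ?ler_norm //; exact: coord.
have aux2 (m a b n v : R) : v <= n -> 0 <= m -> n <= a + b -> v < m + a + b + 2 by lra.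
have B2 (w : plane) j : `|w| <= `|x| + `|y| -> `|w 0 j| < B.
  by move=> h; apply: (aux2 _ _ _ `|w|) => //; exact: coord.
have xB : `|x| <= `|x| + `|y| by rewrite lerDl.
have yB : `|y| <= `|x| + `|y| by rewrite lerDr.
rewrite (compl_const_far oO scO hG BO nOx) ?B2 //.
by rewrite (compl_const_far oO scO hG BO nOy) ?B2.
Qed.

End Complement.

(** * Barycentric coordinates *)

Section Sets3.
Variable I : finType.

Lemma set3_of_mem (T : {set I}) c : #|T| = 3%N -> c \in T ->
  exists a b, [/\ a != b, a != c, b != c & T = [set a; b; c]%SET].
Proof.
move=> T3 cT; have := cardsD1 c T; rewrite T3 cT => -[] /esym /eqP /cards2P.
move=> [a [b [ab Tc]]]; exists a, b.
have : a \in (T :\ c)%SET by rewrite Tc !inE eqxx.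
have : b \in (T :\ c)%SET by rewrite Tc !inE eqxx orbT.
rewrite !inE => /andP[bc _] /andP[ac _]; split=> //.
by rewrite -(finset.setD1K cT) Tc finset.setUC.
Qed.

Lemma set3_of_mem2 (T : {set I}) a b : #|T| = 3%N -> a != b -> a \in T -> b \in T ->
  exists c, [/\ a != c, b != c & T = [set a; b; c]%SET].
Proof.
move=> T3 ab aT bT; have [x [y [xy xb yb TE]]] := set3_of_mem T3 bT.
move: aT; rewrite TE !inE (negbTE ab) orbF => /orP[/eqP ->|/eqP ->].
  exists y; split=> //; first by rewrite eq_sym.
  by apply/setP => z; rewrite !inE; do !case: (_ == _).
exists x; split=> //; rewrite 1?eq_sym //.
by apply/setP => z; rewrite !inE; do !case: (_ == _).
Qed.

Lemma sum_set3 (V : nmodType) (a b c : I) (F : I -> V) :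
  a != b -> a != c -> b != c ->
  \sum_(x in [set a; b; c]%SET) F x = F a + F b + F c.
Proof.
move=> ab ac bc; rewrite finset.setUC big_setU1 /=; last first.
  by rewrite !inE negb_or eq_sym ac eq_sym.
by rewrite big_setU1 /= ?inE // big_set1 addrC.
Qed.

Lemma sum_set3E (V : nmodType) (T : {set I}) (a b c : I) (F : I -> V) :
  T = [set a; b; c]%SET -> a != b -> a != c -> b != c ->
  \sum_(x in T) F x = F a + F b + F c.
Proof. by move=> ->; exact: sum_set3. Qed.

Lemma sum_subset (V : nmodType) (S T : {set I}) (F : I -> V) : S \subset T ->
  \sum_(x in T) (if x \in S then F x else 0) = \sum_(x in S) F x.
Proof.
move=> ST; rewrite -big_mkcondr; apply: eq_bigl => x.
by have [xS|] := boolP (x \in S); rewrite ?andbF // (fintype.subsetP ST).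
Qed.

End Sets3.

Section Barycentric.
Context {R : realType}.
Local Notation plane := 'rV[R]_2.

(** The determinant of two vectors of the plane. *)
Definition cross (u v : plane) : R := u 0 0 * v 0 1 - u 0 1 * v 0 0.

Variables (I : finType) (p : I -> plane).

Lemma hull_interior_cross a b c :
  a != b -> a != c -> b != c -> p a != p b ->
  (hull p [set a; b; c]%SET)° !=set0 -> cross (p b - p a) (p c - p a) != 0.
Proof.
move=> ab ac bc pab [x]; apply: contraPneq => D0.
set u := p b - p a.
have hl y : hull p [set a; b; c]%SET y -> cross u (y - p a) = 0.
  move=> [w [_]]; rewrite !sum_set3 // => w1 ->.
  have -> : w a = 1 - w b - w c by lra.
  move: D0; rewrite /u /cross !mxE => D0.
  transitivity (w c * ((p b 0 0 - p a 0 0) * (p c 0 1 - p a 0 1) -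
                  (p b 0 1 - p a 0 1) * (p c 0 0 - p a 0 0))); first by ring.
  by rewrite D0 mulr0.
(* If a, b, c were on a line, the direction normal to it would leave the
   hull. *)
pose q := pt (- u 0 1) (u 0 0).
have uq : cross u q != 0.
  rewrite /cross pt0 pt1.
  have -> : u 0 0 * u 0 0 - u 0 1 * - u 0 1 = u 0 0 ^+ 2 + u 0 1 ^+ 2 by ring.
  rewrite paddr_eq0 ?sqr_ge0 // !sqrf_eq0; apply: contra pab => /andP[/eqP u0 /eqP u1].
  move: u0 u1; rewrite /u !mxE => u0 u1.
  by apply/eqP/rV2P; lra.
rewrite /interior /= => hx.
have cs := @segment_continuous R _ x (x + q).
have : \forall t \near (0 : R), hull p [set a; b; c]%SET (x + t *: (x + q - x)).
  have := cs 0 (hull p [set a; b; c]%SET).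
  by rewrite scale0r addr0 => /(_ hx); rewrite nbhs_filterE.
move=> /nbhs_ballP[e /= e0 he].
have h1 := hl _ (nbhs_singleton hx).
have : ball (0 : R) e (e / 2) by rewrite /ball /= sub0r normrN gtr0_norm ?divr_gt0 //; lra.
move=> /he /hl; rewrite (addrC x q) addrK => h2.
have : cross u (e / 2 *: q) = 0.
  move: h1 h2; rewrite /cross !mxE => h1 h2.
  by rewrite -[RHS](subrr 0) -[in X in _ = X - _]h2 -h1; ring.
have -> : cross u (e / 2 *: q) = e / 2 * cross u q by rewrite /cross !mxE; ring.
move=> /eqP; rewrite mulf_eq0 (negbTE uq) orbF.
by apply/negP; rewrite gt_eqF // divr_gt0.
Qed.

(** The functions l b, for b in T, are the barycentric coordinates with respect to
    the points p b; l b is irrelevant for b outside T. *)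
Definition barycentric (T : {set I}) (l : I -> plane -> R) :=
  [/\ forall b, continuous (l b), forall x, \sum_(b in T) l b x = 1,
      forall x, x = \sum_(b in T) l b x *: p b
    & forall x (w : I -> R), \sum_(b in T) w b = 1 ->
        x = \sum_(b in T) w b *: p b -> forall b, b \in T -> l b x = w b].

Lemma barycentric_exists (T : {set I}) : injective p -> #|T| = 3%N ->
  (hull p T)° !=set0 -> exists l, barycentric T l.
Proof.
move=> injp T3 hT.
have /finset.set0Pn[c cT] : T != finset.set0 by rewrite -card_gt0 T3.
have [a [b [ab ac bc TE]]] := set3_of_mem T3 cT.
have : cross (p b - p a) (p c - p a) != 0.
  apply: hull_interior_cross => //; first by apply: contra_neq ab => /injp.
  by rewrite -TE.
set D := cross _ _ => D0.
pose lb (x : plane) := cross (x - p a) (p c - p a) / D.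
pose lc (x : plane) := cross (p b - p a) (x - p a) / D.
have cc (r : R) : continuous (fun _ : plane => r).
  exact: cst_continuous.
have cB (f g : plane -> R) : continuous f -> continuous g ->
    continuous (fun x => f x - g x).
  by move=> cf cg x; exact: (continuousB (cf x) (cg x)).
have cM (f g : plane -> R) : continuous f -> continuous g ->
    continuous (fun x => f x * g x).
  by move=> cf cg x; exact: (continuousM (cf x) (cg x)).
have dc j : continuous (fun x : plane => (x - p a) 0 j).
  have -> : (fun x : plane => (x - p a) 0 j) = (fun x => x 0 j - p a 0 j).
    by apply/funext => y; rewrite !mxE.
  by apply: cB; [exact: coord_cts|exact: cc].
have clb : continuous lb.
  by apply: (cM) => //; apply: cB; apply: cM.
have clc : continuous lc.
  by apply: (cM) => //; apply: cB; apply: cM.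
pose l v x := if v == b then lb x else if v == c then lc x else 1 - lb x - lc x.
have la x : l a x = 1 - lb x - lc x by rewrite /l (negbTE ab) (negbTE ac).
have lbE x : l b x = lb x by rewrite /l eqxx.
have lcE x : l c x = lc x by rewrite /l eq_sym (negbTE bc) eqxx.
exists l; split.
- move=> v; rewrite /l; case: (v == b) => //; case: (v == c) => //.
  by apply: (cB) => //; exact: cB.
- by move=> x; rewrite TE (sum_set3 _ ab ac bc) la lbE lcE; ring.
- move=> x; rewrite TE (sum_set3 _ ab ac bc) la lbE lcE.
  by apply: rV2P; rewrite !mxE /lb /lc /cross !mxE; move: D0;
    rewrite /D /cross !mxE => D0; field.
- move=> x w; rewrite TE !(sum_set3 _ ab ac bc) => w1 ->.
  have -> : w a = 1 - w b - w c by lra.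
  have hb : lb ((1 - w b - w c) *: p a + w b *: p b + w c *: p c) = w b.
    by rewrite /lb /cross !mxE; move: D0; rewrite /D /cross !mxE => D0; field.
  have hc : lc ((1 - w b - w c) *: p a + w b *: p b + w c *: p c) = w c.
    by rewrite /lc /cross !mxE; move: D0; rewrite /D /cross !mxE => D0; field.
  move=> v; rewrite !inE => /orP[/orP[|]|] /eqP ->.
  + by rewrite la hb hc; lra.
  + by rewrite lbE.
  + by rewrite lcE.
Qed.

Section Coordinates.
Variables (T : {set I}) (l : I -> plane -> R).
Hypothesis lT : barycentric T l.

Lemma bary_pos v b : v \in T -> b \in T -> l b (p v) = (b == v)%:R.
Proof.
case: lT => _ _ _ uniq vT bT; apply: (uniq _ (fun b => (b == v)%:R)) => //.
  rewrite (bigD1 v) //= eqxx big1 ?addr0 // => i /andP[_ /negbTE ->] //.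
rewrite (bigD1 v) //= eqxx scale1r big1 ?addr0 // => i /andP[_ /negbTE ->].
by rewrite scale0r.
Qed.

Lemma bary_comb (J : finType) (P : pred J) (w : J -> R) (q : J -> plane) b :
  b \in T -> \sum_(j | P j) w j = 1 ->
  l b (\sum_(j | P j) w j *: q j) = \sum_(j | P j) w j * l b (q j).
Proof.
case: lT => _ l1 lx uniq bT w1.
apply: (uniq _ (fun b => \sum_(j | P j) w j * l b (q j))) => //.
  rewrite exchange_big /= -[RHS]w1; apply: eq_bigr => j _.
  by rewrite -mulr_sumr l1 mulr1.
under [RHS]eq_bigr do rewrite scaler_suml.
rewrite exchange_big /=; apply: eq_bigr => j _.
by rewrite [in LHS](lx (q j)) scaler_sumr; apply: eq_bigr => i _; rewrite scalerA.
Qed.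

Lemma bary_segment x y t b : b \in T ->
  l b (x + t *: (y - x)) = l b x + t * (l b y - l b x).
Proof.
move=> bT; have := @bary_comb bool predT (fun i => if i then t else 1 - t)
  (fun i => if i then y else x) b bT.
rewrite !big_bool /= addrC subrK => /(_ erefl).
have -> : t *: y + (1 - t) *: x = x + t *: (y - x).
  by rewrite scalerBr scalerBl scale1r addrCA addrA addrC; congr (_ + _); rewrite addrC.
by move=> ->; ring.
Qed.

Lemma hullP x : hull p T x <-> forall b, b \in T -> 0 <= l b x.
Proof.
case: (lT) => _ l1 lx uniq; split.
  by move=> [w [w0 w1 xw]] b bT; rewrite (uniq _ _ w1 xw) //; exact: w0.
by move=> h; exists (l^~ x); split.
Qed.

Lemma hull_sub (S : {set I}) x (w : I -> R) b : S \subset T ->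
  \sum_(v in S) w v = 1 -> x = \sum_(v in S) w v *: p v -> b \in T ->
  l b x = if b \in S then w b else 0.
Proof.
move=> ST w1 xw; case: lT => _ _ _ uniq.
apply: (uniq x (fun b => if b \in S then w b else 0)).
  by rewrite sum_subset.
rewrite xw -(sum_subset _ ST); apply: eq_bigr => v _.
by case: ifP => // _; rewrite scale0r.
Qed.

Lemma hull_near x : ~ hull p T x -> \forall y \near x, ~ hull p T y.
Proof.
case: (lT) => cl _ _ _ nTx.
have [b bT bx] : exists2 b, b \in T & l b x < 0.
  apply: contrapT => h; apply: nTx; apply/hullP => b bT.
  by rewrite leNgt; apply/negP => bx; apply: h; exists b.
have : \forall y \near x, l b y < 0.
  exact: (@cvgr_lt _ _ _ _ (l b) (l b x) (cl b x)).
by apply: filterS => y yb /hullP /(_ _ bT); rewrite leNgt yb.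
Qed.

Lemma bary_near_gt x : \forall y \near x, forall b, 0 < l b x -> 0 < l b y.
Proof.
case: (lT) => cl _ _ _.
suff h b : \forall y \near x, 0 < l b x -> 0 < l b y.
  exact: (@filter_forall _ _ (fun b y => 0 < l b x -> 0 < l b y) (nbhs x) (nbhs_filter x) h).
have [bx|bx] := ltP 0 (l b x); last by apply: (@filterE _ _ (nbhs_filter x)).
have : \forall y \near x, 0 < l b y.
  exact: (@cvgr_gt _ _ _ _ (l b) (l b x) (cl b x)).
by apply: filterS => y yb _.
Qed.

End Coordinates.
End Barycentric.

(** * Closed cochains on a triangulation *)

Section Triangulation.
Context {R : realType} (Omega : set 'rV[R]_2) (M : mesh R).
Local Notation plane := 'rV[R]_2.
Local Notation p := (@pos R M).
Hypothesis oO : open Omega.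
Hypothesis clO : (closure Omega)° = Omega.
Hypothesis HM : triangulation M Omega.

Variable L : {set vertex M} -> vertex M -> plane -> R.
Hypothesis hL : forall T, T \in triangles M -> barycentric p T (L T).

Lemma frontierP (x : plane) : frontier Omega x <-> closure Omega x /\ ~ Omega x.
Proof.
by rewrite /frontier /setD /=; have /interior_id -> := oO.
Qed.

Lemma closure_elt (x : plane) :
  closure Omega x <-> exists2 T, T \in triangles M & elt T x.
Proof.
have [_ _ _ _ ->] := HM; split.
  by move=> [T /= hT Tx]; exists T.
by move=> [T hT Tx]; exists T.
Qed.

Lemma tri_card T : T \in triangles M -> #|T| = 3%N.
Proof. by have [_ _ h _ _] := HM; move=> /h[]. Qed.

Lemma elt_convex T : T \in triangles M -> segment_closed (elt T).
Proof.
move=> hT x y /(hullP (hL hT)) hx /(hullP (hL hT)) hy t /andP[t0 t1].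
apply/(hullP (hL hT)) => b bT; rewrite (bary_segment (hL hT)) //.
by have := hx _ bT; have := hy _ bT; nra.
Qed.

Lemma elt_vertex T a : T \in triangles M -> a \in T -> elt T (p a).
Proof.
move=> hT aT; apply/(hullP (hL hT)) => b bT.
by rewrite (bary_pos (hL hT)) // ler0n.
Qed.

Lemma elt_near (x : plane) : \forall y \near x,
  forall T, T \in triangles M -> elt T y -> elt T x.
Proof.
have h T : \forall y \near x, T \in triangles M -> elt T y -> elt T x.
  have [hT|hT] := boolP (T \in triangles M); last first.
    exact: (@filterE _ _ (nbhs_filter x)).
  have [Tx|nTx] := pselect (elt T x); first exact: (@filterE _ _ (nbhs_filter x)).
  by have := hull_near (hL hT) nTx; apply: filterS => y nTy _ /nTy.
exact: (@filter_forall _ _ (fun T y => T \in triangles M -> elt T y -> elt T x)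
  (nbhs x) (nbhs_filter x) h).
Qed.

Lemma bary_near (x : plane) : \forall y \near x,
  forall T, T \in triangles M -> forall b, 0 < L T b x -> 0 < L T b y.
Proof.
have h T : \forall y \near x, T \in triangles M ->
    forall b, 0 < L T b x -> 0 < L T b y.
  have [hT|hT] := boolP (T \in triangles M); last first.
    exact: (@filterE _ _ (nbhs_filter x)).
  by have := bary_near_gt (hL hT) x; apply: filterS => y hy _.
exact: (@filter_forall _ _ (fun T y => T \in triangles M ->
  forall b, 0 < L T b x -> 0 < L T b y) (nbhs x) (nbhs_filter x) h).
Qed.

(** A point with positive barycentric coordinates is interior to the closure of
    Omega, which is Omega. *)
Lemma interior_tri T x : T \in triangles M ->
  (forall b, b \in T -> 0 < L T b x) -> Omega x.
Proof.
move=> hT hx; rewrite -clO /interior /=.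
have := bary_near_gt (hL hT) x; apply: filterS => y hy.
apply/closure_elt; exists T => //; apply/(hullP (hL hT)) => b bT.
exact/ltW/hy/hx.
Qed.

Lemma common_face T T' x : T \in triangles M -> T' \in triangles M ->
  elt T x -> elt T' x -> exists w : vertex M -> R,
  [/\ \sum_(v in (T :&: T')%SET) w v = 1,
      x = \sum_(v in (T :&: T')%SET) w v *: p v,
      forall v, v \in T -> L T v x = if v \in (T :&: T')%SET then w v else 0
    & forall v, v \in T' -> L T' v x = if v \in (T :&: T')%SET then w v else 0].
Proof.
move=> hT hT' Tx T'x; have [_ _ _ inter _] := HM.
have : (elt T `&` elt T') x by split.
rewrite inter // => -[w [_ w1 xw]]; exists w; split => // v vT.
  exact: (hull_sub (hL hT) (finset.subsetIl _ _) w1 xw vT).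
exact: (hull_sub (hL hT') (finset.subsetIr _ _) w1 xw vT).
Qed.

Lemma face_mem T T' x v : T \in triangles M -> T' \in triangles M ->
  elt T x -> elt T' x -> v \in T -> 0 < L T v x -> v \in T' /\ L T' v x = L T v x.
Proof.
move=> hT hT' Tx T'x vT.
have [w [_ _ h1 h2]] := common_face hT hT' Tx T'x.
rewrite h1 //; case: ifPn => vTT' w0; last by rewrite ltxx in w0.
by move: (vTT'); rewrite !inE => /andP[_ vT']; split=> //; rewrite h2 // vTT'.
Qed.

(** Let m be a frontier point in the relative interior of the edge ab. If some
    point of this edge were in Omega, there would be a triangle across the edge,
    and m would be interior to the union of the two triangles, hence in Omega. *)
Lemma edge_frontier a b c m : [set a; b; c]%SET \in triangles M ->
  a != b -> a != c -> b != c ->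
  0 < L [set a; b; c]%SET a m -> 0 < L [set a; b; c]%SET b m ->
  L [set a; b; c]%SET c m = 0 -> ~ Omega m ->
  elt [set a; b]%SET `<=` frontier Omega.
Proof.
set T := [set a; b; c]%SET => hT ab ac bc ma mb mc nOm m' m'ab.
have lT := hL hT.
have aT : a \in T by rewrite !inE eqxx.
have bT : b \in T by rewrite !inE eqxx orbT.
have cT : c \in T by rewrite !inE eqxx orbT.
have abT : [set a; b]%SET \subset T by apply: finset.subsetUl.
have TE v : v \in T -> [\/ v = a, v = b | v = c].
  by rewrite !inE => /orP[/orP[|]|] /eqP ->; [apply: Or31|apply: Or32|apply: Or33].
have [w [w0 w1 m'E]] := m'ab.
have m'a : 0 <= L T a m'.
  by rewrite (hull_sub lT abT w1 m'E aT); case: ifP => // /w0.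
have m'b : 0 <= L T b m'.
  by rewrite (hull_sub lT abT w1 m'E bT); case: ifP => // /w0.
have m'c : L T c m' = 0.
  by rewrite (hull_sub lT abT w1 m'E cT) !inE eq_sym (negbTE ac) eq_sym (negbTE bc).
have Tm' : elt T m'.
  by apply/(hullP lT) => v /TE [->|->|->] //; rewrite m'c.
apply/frontierP; split; first by apply/closure_elt; exists T.
move=> Om'; apply: nOm.
have nearO x : Omega x -> \forall y \near x, Omega y.
  by move=> Ox; exact: (open_nbhs_nbhs (conj oO Ox)).
have near0 (x y : plane) : Omega x -> exists2 t : R, 0 < t <= 1 &
    Omega (x + t *: (y - x)) /\
    forall T', T' \in triangles M -> elt T' (x + t *: (y - x)) -> elt T' x.
  move=> Ox; have hx := @filterI _ _ (nbhs_filter x) _ _ (nearO _ Ox) (elt_near x).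
  have := @segment_continuous R _ x y 0 _.
  rewrite scale0r addr0 => /(_ _ hx); rewrite nbhs_filterE => /nbhs_ballP[e /= e0 he].
  exists (Num.min 1 (e / 2)).
    by rewrite lt_min ltr01 divr_gt0 // ge_min lexx.
  apply: he; rewrite /ball /= sub0r normrN gtr0_norm.
    by rewrite gt_min; apply/orP; right; lra.
  by rewrite lt_min ltr01 divr_gt0.
(* Moving m' a little towards m gives a point of the open edge in Omega. *)
have [t /andP[t0 t1] [Om2 _]] := near0 m' m Om'.
set m2 := m' + _ in Om2.
have m2a : 0 < L T a m2 by rewrite (bary_segment lT) //; nra.
have m2b : 0 < L T b m2 by rewrite (bary_segment lT) //; nra.
have m2c : L T c m2 = 0 by rewrite (bary_segment lT) // m'c mc; ring.
have Tm2 : elt T m2.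
  by apply/(hullP lT) => v /TE [->|->|->]; rewrite ?m2c // ltW.
clearbody m2.
(* Moving away from the vertex c gives a point z of Omega across the edge;
   the triangle T' containing z also contains m2, hence the edge. *)
have [s /andP[s0 s1] [Oz zT]] := near0 m2 (m2 + (m2 - p c)) Om2.
set z := m2 + _ in Oz zT.
have zc : L T c z < 0.
  rewrite (bary_segment lT) //.
  have -> : m2 + (m2 - p c) = p c + 2 *: (m2 - p c).
    by rewrite scaler_nat mulr2n (addrA (p c)) (addrC (p c) (m2 - p c)) subrK.
  by rewrite (bary_segment lT) // m2c (bary_pos lT) // eqxx /=; nra.
have /closure_elt[T' hT' T'z] := subset_closure Oz.
have lT' := hL hT'; have T'm2 := zT _ hT' T'z.
have [aT' _] := face_mem hT hT' Tm2 T'm2 aT m2a.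
have [bT' _] := face_mem hT hT' Tm2 T'm2 bT m2b.
have [c' [ac' bc' T'E]] := set3_of_mem2 (tri_card hT') ab aT' bT'.
have c'T' : c' \in T' by rewrite T'E !inE eqxx orbT.
have TE' v : v \in T' -> [\/ v = a, v = b | v = c'].
  by rewrite T'E !inE => /orP[/orP[|]|] /eqP ->; [apply: Or31|apply: Or32|apply: Or33].
(* The coordinate of T at c vanishes on the edge, so it is proportional to
   the coordinate of T' at its third vertex. *)
have LcE x : L T c x = L T' c' x * L T c (p c').
  have [_ l1 lx _] := lT'.
  rewrite {1}(lx x) (bary_comb lT _ cT (l1 x)) (sum_set3E _ T'E ab ac' bc').
  rewrite (bary_pos lT aT) // (bary_pos lT bT) // (eq_sym c a) (negbTE ac) (eq_sym c b) (negbTE bc).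
  by rewrite !mulr0 !add0r.
have pc' : L T c (p c') < 0.
  have /(hullP lT') /(_ _ c'T') := T'z.
  by move: zc; rewrite LcE; nra.
have mE : m = \sum_(v in [set a; b]%SET) L T v m *: p v.
  have [_ _ lx _] := lT; rewrite {1}(lx m) (sum_set3E _ erefl ab ac bc) -/T mc scale0r addr0.
  by rewrite big_setU1 /= ?inE // big_set1.
have m1 : \sum_(v in [set a; b]%SET) L T v m = 1.
  have [_ l1 _ _] := lT; rewrite -(l1 m) (sum_set3E _ erefl ab ac bc) -/T mc addr0.
  by rewrite big_setU1 /= ?inE // big_set1.
have abT' : [set a; b]%SET \subset T' by rewrite T'E; apply: finset.subsetUl.
have ma' : 0 < L T' a m.
  by rewrite (hull_sub lT' abT' m1 mE aT') !inE eqxx.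
have mb' : 0 < L T' b m.
  by rewrite (hull_sub lT' abT' m1 mE bT') !inE eqxx orbT.
rewrite -clO /interior /=.
have := bary_near m; apply: filterS => y hy; apply/closure_elt.
have [yc|yc] := leP 0 (L T c y).
  exists T => //; apply/(hullP lT) => v /TE [->|->|->] //; exact/ltW/hy.
exists T' => //; apply/(hullP lT') => v /TE' [->|->|->]; try exact/ltW/hy.
by move: yc; rewrite LcE; nra.
Qed.

Section Cochain.
Variable d : vertex M -> vertex M -> R.
Hypothesis d_bd : forall a b, boundary_edge Omega a b -> d a b = 0.
Variable e : {set vertex M} -> vertex M -> R.
Hypothesis he : forall T a b, T \in triangles M -> a \in T -> b \in T ->
  d a b = e T b - e T a.

(** The affine function on the triangle T whose value at each vertex b is e T b. *)
Definition pw_affine (T : {set vertex M}) (x : plane) : R := \sum_(b in T) L T b x * e T b.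
Local Notation W := pw_affine.

Lemma pw_affine_vertex T a : T \in triangles M -> a \in T -> W T (p a) = e T a.
Proof.
move=> hT aT; rewrite /W (bigD1 a) //= (bary_pos (hL hT)) // eqxx mul1r.
rewrite big1 ?addr0 // => b /andP[bT ba].
by rewrite (bary_pos (hL hT)) // (negbTE ba) mul0r.
Qed.

Lemma pw_affine_diff T T' x y : T \in triangles M -> T' \in triangles M ->
  elt T x -> elt T' x -> elt T y -> elt T' y -> W T y - W T x = W T' y - W T' x.
Proof.
move=> hT hT' Tx T'x Ty T'y.
suff [k hk] : exists k, forall z, elt T z -> elt T' z -> W T z - W T' z = k.
  by have := hk _ Tx T'x; have := hk _ Ty T'y; lra.
have [S0|/finset.set0Pn[s sS]] := eqVneq (T :&: T')%SET finset.set0.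
  exists 0 => z Tz T'z; have [w [w1 _ _ _]] := common_face hT hT' Tz T'z.
  by move: w1; rewrite S0 big_set0 => /eqP; rewrite eq_sym oner_eq0.
have /setIP[sT sT'] := sS.
exists (e T s - e T' s) => z Tz T'z.
have [w [w1 _ h1 h2]] := common_face hT hT' Tz T'z.
have WS (U : {set vertex M}) : (T :&: T')%SET \subset U ->
    (forall v, v \in U -> L U v z = if v \in (T :&: T')%SET then w v else 0) ->
    W U z = \sum_(v in (T :&: T')%SET) w v * e U v.
  move=> SU h; rewrite /W -(sum_subset _ SU); apply: eq_bigr => v vU.
  by rewrite h //; case: ifP => _; rewrite ?mul0r.
rewrite (WS T) ?finset.subsetIl // (WS T') ?finset.subsetIr // -sumrB.
rewrite -[RHS]mul1r -w1 mulr_suml; apply: eq_bigr => v /setIP[vT vT'].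
rewrite -mulrBr; congr (_ * _).
by have := he hT sT vT; have := he hT' sT' vT'; lra.
Qed.

(** The germ at x of the piecewise constant form with tangential integrals d: the
    increment of the affine function of any triangle containing both points. It
    is 0 when there is no such triangle, in particular outside the closure of
    Omega. *)
Definition mesh_germ (x y : plane) : R :=
  match pselect (exists T, [/\ T \in triangles M, elt T x & elt T y]) with
  | left h => let T := projT1 (cid h) in W T y - W T x
  | right _ => 0
  end.

Lemma mesh_germE T x y : T \in triangles M -> elt T x -> elt T y ->
  mesh_germ x y = W T y - W T x.
Proof.
move=> hT Tx Ty; rewrite /mesh_germ; case: pselect => [h|]; last first.
  by case; exists T.
by case: (cid h) => T' /= [hT' T'x T'y]; exact: pw_affine_diff.
Qed.

Lemma mesh_germ0 x y : (forall T, T \in triangles M -> elt T x -> ~ elt T y) ->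
  mesh_germ x y = 0.
Proof.
move=> h; rewrite /mesh_germ; case: pselect => // -[T [hT Tx Ty]].
by case: (h T).
Qed.

(** Two nearby frontier points in a triangle lie on one of its edges; if they are
    distinct, this is a boundary edge, on which d vanishes. *)
Lemma mesh_germ_frontier x : ~ Omega x -> \forall y \near x, ~ Omega y ->
  mesh_germ x y = 0.
Proof.
move=> nOx; have := bary_near x; apply: filterS => y hxy nOy.
have [[T [hT Tx Ty]]|h] := pselect (exists T, [/\ T \in triangles M, elt T x & elt T y]);
  last first.
  by apply: mesh_germ0 => T hT Tx Ty; apply: h; exists T.
rewrite (mesh_germE hT) //; have lT := hL hT.
have Tx0 := (hullP lT x).1 Tx; have Ty0 := (hullP lT y).1 Ty.
have [c cT yc] : exists2 c, c \in T & L T c y = 0.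
  apply: contrapT => h; apply: nOy; apply: (interior_tri hT) => b bT.
  rewrite lt_neqAle Ty0 // andbT eq_sym; apply/eqP => yb.
  by apply: h; exists b.
have [a [b [ab ac bc TE]]] := set3_of_mem (tri_card hT) cT.
have aT : a \in T by rewrite TE !inE eqxx.
have bT : b \in T by rewrite TE !inE eqxx orbT.
have xc : L T c x = 0.
  by apply/eqP; move: (Tx0 _ cT); rewrite le_eqVlt eq_sym => /orP[//|/(hxy _ hT)]; rewrite yc ltxx.
have WE z : L T c z = 0 -> W T z = e T a + L T b z * d a b.
  move=> zc; have [_ l1 _ _] := lT; have := l1 z.
  rewrite /W !(sum_set3E _ TE ab ac bc) zc (he hT aT bT).
  move=> h; have -> : L T a z = 1 - L T b z by lra.
  by ring.
rewrite !WE //.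
have [xyb|xyb] := eqVneq (L T b x) (L T b y); first by rewrite xyb; ring.
have l1 z : L T c z = 0 -> L T a z = 1 - L T b z.
  move=> zc; have [_ + _ _] := lT => /(_ z); rewrite (sum_set3E _ TE ab ac bc) zc; lra.
have yb : 0 < L T b y.
  rewrite lt_neqAle Ty0 // andbT eq_sym; apply: contra_neq xyb => yb.
  rewrite yb; apply/eqP; move: (Tx0 _ bT); rewrite le_eqVlt eq_sym => /orP[//|/(hxy _ hT)].
  by rewrite yb ltxx.
have ya : 0 < L T a y.
  rewrite lt_neqAle Ty0 // andbT eq_sym; apply: contra_neq xyb => ya.
  have xa : L T a x = 0.
    apply/eqP; move: (Tx0 _ aT); rewrite le_eqVlt eq_sym => /orP[//|/(hxy _ hT)].
    by rewrite ya ltxx.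
  by move: (l1 _ xc) (l1 _ yc); rewrite xa ya; lra.
rewrite (d_bd (a := a) (b := b)) ?mulr0 ?subrr //.
split; first by split=> //; exists T => //; rewrite TE; apply: finset.subsetUl.
by apply: (@edge_frontier a b c y); rewrite -?TE.
Qed.

Lemma mesh_germ_closed : closed_germs setT mesh_germ.
Proof.
have nearC x : ~ closure Omega x -> \forall y \near x, ~ closure Omega y.
  move=> nCx; have /closed_openC oC := @closed_closure _ Omega.
  by have := open_nbhs_nbhs (conj oC nCx).
have germx x : mesh_germ x x = 0.
  have [/closure_elt[T hT Tx]|nCx] := pselect (closure Omega x).
    by rewrite (mesh_germE hT) // subrr.
  by apply: mesh_germ0 => T hT Tx; case: nCx; apply/closure_elt; exists T.
have germC x y : ~ closure Omega y -> mesh_germ x y = 0.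
  move=> nCy; apply: mesh_germ0 => T hT _ Ty; apply: nCy.
  by apply/closure_elt; exists T.
have fr (x : plane) : \forall y \near x, ~ Omega y -> mesh_germ x y = 0.
  have [Ox|nOx] := pselect (Omega x).
    have : \forall y \near x, Omega y by exact: (open_nbhs_nbhs (conj oO Ox)).
    by apply: filterS.
  exact: mesh_germ_frontier.
move=> x _; have := fr x; have := elt_near x; apply: filterS2 => y eyx fy.
have [Cy|nCy] := pselect (closure Omega y); last first.
  have := nearC _ nCy; apply: filterS => z nCz.
  by rewrite !germC.
have [Oy|nOy] := pselect (Omega y).
  have : \forall z \near y, Omega z by exact: (open_nbhs_nbhs (conj oO Oy)).
  have := elt_near y; apply: filterS2 => z ezy Oz.
  have /closure_elt[T hT Tz] := subset_closure Oz.
  have Ty := ezy _ hT Tz; have Tx := eyx _ hT Ty.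
  by rewrite !(mesh_germE hT) //; ring.
have := elt_near y; apply: filterS => z ezy.
have [/closure_elt[T hT Tz]|nCz] := pselect (closure Omega z).
  have Ty := ezy _ hT Tz; have Tx := eyx _ hT Ty.
  by rewrite !(mesh_germE hT) //; ring.
by rewrite !(germC _ z) // germx fy.
Qed.

End Cochain.

Lemma cochain_exact_aux (d : vertex M -> vertex M -> R) e :
  bounded_set Omega -> simply_connected Omega ->
  (forall T a b, T \in triangles M -> a \in T -> b \in T -> d a b = e T b - e T a) ->
  (forall a b, boundary_edge Omega a b -> d a b = 0) ->
  exists2 g : vertex M -> R, forall a, boundary_vertex Omega a -> g a = 0 &
  forall T a b, T \in triangles M -> a \in T -> b \in T -> d a b = g b - g a.
Proof.
move=> bO scO he d_bd.
have [G hG] := simply_connected_primitive openT simply_connected_plane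
  (mesh_germ_closed d_bd he).
have germx x : mesh_germ e x x = 0.
  have [[T hT Tx]|nCx] := pselect (exists2 T, T \in triangles M & elt T x).
    by rewrite (mesh_germE he hT) // subrr.
  by apply: mesh_germ0 => T hT Tx; case: nCx; exists T.
have Gfr x : ~ Omega x -> \forall y \near x, ~ Omega y -> G y = G x.
  move=> nOx; have := mesh_germ_frontier d_bd he nOx; have := hG x I.
  apply: filterS2 => y /(_ I) h h0 /h0 e0; move: h; rewrite germx e0; lra.
have GT T a b : T \in triangles M -> a \in T -> b \in T -> d a b = G (p b) - G (p a).
  move=> hT aT bT.
  have : G (p a) - pw_affine e T (p a) = G (p b) - pw_affine e T (p b).
    apply: (@locally_const_convex R _ (elt T) (fun x => G x - pw_affine e T x)).
    - exact: elt_convex.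
    - move=> x Tx; have := hG x I; apply: filterS => y /(_ I) h Ty.
      move: h; rewrite germx (mesh_germE he hT) //; lra.
    - exact: elt_vertex.
    - exact: elt_vertex.
  rewrite !pw_affine_vertex // (he T) //; lra.
have [[a0 bd0]|nbd] := pselect (exists a : vertex M, boundary_vertex Omega a).
  exists (fun a => G (p a) - G (p a0)) => [a bda|T a b hT aT bT].
    apply/eqP; rewrite subr_eq0; apply/eqP.
    by apply: (compl_const oO bO scO Gfr);
      [have /frontierP[] := bda|have /frontierP[] := bd0].
  by rewrite (GT T) //; ring.
exists (fun a => G (p a)) => [a bda|T a b hT aT bT]; last exact: (GT T).
by case: nbd; exists a.
Qed.

End Triangulation.

(** The relative cohomology of a triangulated simply connected domain modulo its
    boundary vanishes in degree 1: a closed cochain that vanishes on boundary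
    edges is the coboundary of a function that vanishes at boundary vertices. *)
Theorem cochain_exact (R : realType) (Omega : set 'rV[R]_2) (M : mesh R)
    (d : vertex M -> vertex M -> R) :
  polygonal_domain Omega -> simply_connected Omega -> triangulation M Omega ->
  (forall T a b c, T \in triangles M -> a \in T -> b \in T -> c \in T ->
     d a b + d b c = d a c) ->
  (forall a b, boundary_edge Omega a b -> d a b = 0) ->
  exists2 g : vertex M -> R, forall a, boundary_vertex Omega a -> g a = 0 &
  forall T a b, T \in triangles M -> a \in T -> b \in T -> d a b = g b - g a.
Proof.
move=> [[_ oO _] bO clO _] scO HM dT d_bd.
have [injp _ tri _ _] := HM.
have : forall T, exists l, T \in triangles M -> barycentric (@pos R M) T l.
  move=> T; have [hT|] := boolP (T \in triangles M); last by exists (fun _ _ => 0).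
  have [T3 iT] := tri _ hT.
  by have [l hl] := barycentric_exists injp T3 iT; exists l.
move=> /choice[L hL].
have : forall T, exists e : vertex M -> R, T \in triangles M ->
    forall a b, a \in T -> b \in T -> d a b = e b - e a.
  move=> T; have [hT|] := boolP (T \in triangles M); last by exists (fun=> 0).
  have /finset.set0Pn[a0 a0T] : T != finset.set0 by rewrite -card_gt0 (tri _ hT).1.
  exists (d a0) => _ a b aT bT.
  by have := dT T _ _ _ hT a0T aT bT; lra.
move=> /choice[e he].
exact: (cochain_exact_aux oO clO HM hL bO scO (fun T a b hT => he T hT a b)).
Qed.

(** * Bivariate cubics and Simpson's rule *)

Section Poly2.
Context {R : realType}.
Local Notation plane := 'rV[R]_2.

(** The coefficient of x^i y^j, for i and j at most k; it is 0 when i + j > k. An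
    index above k would be read as 0 by inord. *)
Definition coef k (p : poly2 R k) (i j : nat) : R :=
  oapp (fun m : monomial k => p m) 0
    (insub ((inord i, inord j) : 'I_k.+1 * 'I_k.+1)).

Lemma coefD k (p q : poly2 R k) i j : coef (p + q) i j = coef p i j + coef q i j.
Proof. by rewrite /coef; case: insubP => /= [m _ _|_]; rewrite ?ffunE ?addr0. Qed.

Lemma coefZ k (a : R) (p : poly2 R k) i j : coef (a *: p) i j = a * coef p i j.
Proof. by rewrite /coef; case: insubP => /= [m _ _|_]; rewrite ?ffunE ?mulr0. Qed.

Lemma coef_out k (p : poly2 R k) i j : (i <= k)%N -> (j <= k)%N -> (k < i + j)%N ->
  coef p i j = 0.
Proof.
move=> ik jk kij; rewrite /coef insubF //=.
by rewrite !inordK // leqNgt kij.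
Qed.

Lemma coef_inj k (p q : poly2 R k) :
  (forall i j, (i + j <= k)%N -> coef p i j = coef q i j) -> p = q.
Proof.
move=> h; apply/ffunP => -[[i j] ij].
have := h _ _ ij; rewrite /coef !inord_val /=.
by rewrite insubT /=.
Qed.

Lemma peval_coef k (p : poly2 R k) (x : plane) :
  peval p x = \sum_(i < k.+1) \sum_(j < k.+1) coef p i j * x 0 0 ^+ i * x 0 1 ^+ j.
Proof.
rewrite pair_bigA /= (bigID (fun ij : 'I_k.+1 * 'I_k.+1 => (ij.1 + ij.2 <= k)%N)) /=.
rewrite [X in _ = _ + X]big1 ?addr0; last first.
  move=> [i j] /=; rewrite -ltnNge => h.
  by rewrite coef_out ?mul0r // -ltnS.
rewrite /peval (reindex_omap (val : monomial k -> _) insub) /=; last first.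
  by move=> ij hij; rewrite insubT.
apply: eq_big => [m|m _]; first by rewrite (valP m) valK eqxx.
by rewrite /coef !inord_val -surjective_pairing valK.
Qed.

Lemma peval3E (p : poly2 R 3) (x : plane) : peval p x =
  coef p 0 0 + coef p 1 0 * x 0 0 + coef p 0 1 * x 0 1
  + coef p 2 0 * x 0 0 ^+ 2 + coef p 1 1 * x 0 0 * x 0 1 + coef p 0 2 * x 0 1 ^+ 2
  + coef p 3 0 * x 0 0 ^+ 3 + coef p 2 1 * x 0 0 ^+ 2 * x 0 1
  + coef p 1 2 * x 0 0 * x 0 1 ^+ 2 + coef p 0 3 * x 0 1 ^+ 3.
Proof.
rewrite peval_coef !big_ord_recr !big_ord0 /=.
rewrite [coef p 1 3]coef_out // [coef p 2 2]coef_out // [coef p 2 3]coef_out //.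
rewrite [coef p 3 1]coef_out // [coef p 3 2]coef_out // [coef p 3 3]coef_out //.
by ring.
Qed.

Lemma peval1E (p : poly2 R 1) (x : plane) : peval p x =
  coef p 0 0 + coef p 1 0 * x 0 0 + coef p 0 1 * x 0 1.
Proof.
rewrite peval_coef !big_ord_recr !big_ord0 /=.
rewrite [coef p 1 1]coef_out //.
by ring.
Qed.

Lemma poly2_coef k (c : nat -> nat -> R) : exists p : poly2 R k,
  forall i j, (i + j <= k)%N -> coef p i j = c i j.
Proof.
exists [ffun m : monomial k => c (val m).1 (val m).2] => i j ij.
have ik : (i < k.+1)%N by rewrite ltnS (leq_trans _ ij) ?leq_addr.
have jk : (j < k.+1)%N by rewrite ltnS (leq_trans _ ij) ?leq_addl.
rewrite /coef insubT /=; first by rewrite !inordK.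
by move=> h; rewrite ffunE /= !inordK.
Qed.

End Poly2.

Section Simpson.
Context {R : realType}.

(** Simpson's rule is exact on cubics. *)
Lemma simpson (f : R -> R) c0 c1 c2 c3 :
  (forall t, f t = c0 + c1 * t + c2 * t ^+ 2 + c3 * t ^+ 3) ->
  \int[lebesgue_measure]_(t in `[0, 1]) f t = (f 0 + 4 * f 2^-1 + f 1) / 6.
Proof.
move=> hf.
pose p : {poly R} := c0%:P + c1 *: 'X + c2 *: 'X^2 + c3 *: 'X^3.
pose P : {poly R} := c0 *: 'X^1 + (c1 / 2) *: 'X^2 + (c2 / 3) *: 'X^3 + (c3 / 4) *: 'X^4.
have fE : f = horner p.
  by apply/funext => t; rewrite hf /p !(hornerD, hornerZ, hornerXn, hornerX, hornerC).
have dP t : (P^`()).[t] = p.[t].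
  rewrite /P /p !derivD !derivZ !derivXn /=.
  by rewrite !(hornerD, hornerZ, hornerMn, hornerXn, hornerX, hornerC); field.
rewrite fE /Rintegral (@continuous_FTC2 _ (horner p) (horner P)) //.
- by rewrite -fE !hf /= /P !(hornerD, hornerZ, hornerXn); field.
- exact/continuous_subspaceT/continuous_horner.
- split.
  + by move=> x _; exact: derivable_horner.
  + by apply: cvg_at_right_filter; exact: continuous_horner.
  + by apply: cvg_at_left_filter; exact: continuous_horner.
- by move=> x _; rewrite -derivE dP.
Qed.

End Simpson.

(** * Gradients and edge conditions *)

Section Gradient.
Context {R : realType}.
Local Notation plane := 'rV[R]_2.
Implicit Types (p : poly2 R 3) (x u w : plane).

Lemma pevalD k (p q : poly2 R k) x : peval (p + q) x = peval p x + peval q x.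
Proof.
by rewrite /peval -big_split; apply: eq_bigr => m _; rewrite ffunE !mulrDl.
Qed.

Lemma pevalZ k a (p : poly2 R k) x : peval (a *: p) x = a * peval p x.
Proof.
rewrite /peval mulr_sumr; apply: eq_bigr => m _.
by rewrite ffunE /= !mulrA.
Qed.

(** gradx p x and grady p x are the partial derivatives of p at x. *)
Definition gradx p x : R :=
  coef p 1 0 + 2 * coef p 2 0 * x 0 0 + coef p 1 1 * x 0 1
  + 3 * coef p 3 0 * x 0 0 ^+ 2 + 2 * coef p 2 1 * x 0 0 * x 0 1
  + coef p 1 2 * x 0 1 ^+ 2.

Definition grady p x : R :=
  coef p 0 1 + coef p 1 1 * x 0 0 + 2 * coef p 0 2 * x 0 1
  + coef p 2 1 * x 0 0 ^+ 2 + 2 * coef p 1 2 * x 0 0 * x 0 1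
  + 3 * coef p 0 3 * x 0 1 ^+ 2.

(** The derivative of p at x in the direction u. *)
Definition dirder p x u : R := gradx p x * u 0 0 + grady p x * u 0 1.

Lemma gradxD p q x : gradx (p + q) x = gradx p x + gradx q x.
Proof. by rewrite /gradx !coefD; ring. Qed.
Lemma gradxZ a p x : gradx (a *: p) x = a * gradx p x.
Proof. by rewrite /gradx !coefZ; ring. Qed.
Lemma gradyD p q x : grady (p + q) x = grady p x + grady q x.
Proof. by rewrite /grady !coefD; ring. Qed.
Lemma gradyZ a p x : grady (a *: p) x = a * grady p x.
Proof. by rewrite /grady !coefZ; ring. Qed.

Lemma pevalB k (p q : poly2 R k) x : peval (p - q) x = peval p x - peval q x.
Proof. by rewrite -scaleN1r pevalD pevalZ mulN1r. Qed.
Lemma gradxB p q x : gradx (p - q) x = gradx p x - gradx q x.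
Proof. by rewrite -scaleN1r gradxD gradxZ mulN1r. Qed.
Lemma gradyB p q x : grady (p - q) x = grady p x - grady q x.
Proof. by rewrite -scaleN1r gradyD gradyZ mulN1r. Qed.

(** taylor2 and taylor3 are the coefficients of h^2 and h^3 in p (x + h u). *)
Definition taylor2 p x u : R :=
  coef p 2 0 * u 0 0 ^+ 2 + coef p 1 1 * u 0 0 * u 0 1 + coef p 0 2 * u 0 1 ^+ 2
  + 3 * coef p 3 0 * x 0 0 * u 0 0 ^+ 2
  + coef p 2 1 * (2 * x 0 0 * u 0 0 * u 0 1 + x 0 1 * u 0 0 ^+ 2)
  + coef p 1 2 * (x 0 0 * u 0 1 ^+ 2 + 2 * x 0 1 * u 0 0 * u 0 1)
  + 3 * coef p 0 3 * x 0 1 * u 0 1 ^+ 2.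

Definition taylor3 p u : R :=
  coef p 3 0 * u 0 0 ^+ 3 + coef p 2 1 * u 0 0 ^+ 2 * u 0 1
  + coef p 1 2 * u 0 0 * u 0 1 ^+ 2 + coef p 0 3 * u 0 1 ^+ 3.

Lemma peval_taylor p x u h : peval p (x + h *: u) =
  peval p x + h * dirder p x u + h ^+ 2 * taylor2 p x u + h ^+ 3 * taylor3 p u.
Proof.
by rewrite !peval3E /dirder /gradx /grady /taylor2 /taylor3 !mxE; ring.
Qed.

Lemma dirder_taylor p x u w : exists c1 c2, forall h,
  dirder p (x + h *: u) w = dirder p x w + c1 * h + c2 * h ^+ 2.
Proof.
exists (2 * coef p 2 0 * u 0 0 * w 0 0 + coef p 1 1 * (u 0 1 * w 0 0 + u 0 0 * w 0 1)
  + 2 * coef p 0 2 * u 0 1 * w 0 1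
  + 6 * coef p 3 0 * x 0 0 * u 0 0 * w 0 0
  + 2 * coef p 2 1 * ((x 0 0 * u 0 1 + x 0 1 * u 0 0) * w 0 0 + x 0 0 * u 0 0 * w 0 1)
  + 2 * coef p 1 2 * (x 0 1 * u 0 1 * w 0 0 + (x 0 0 * u 0 1 + x 0 1 * u 0 0) * w 0 1)
  + 6 * coef p 0 3 * x 0 1 * u 0 1 * w 0 1).
exists (3 * coef p 3 0 * u 0 0 ^+ 2 * w 0 0
  + coef p 2 1 * (2 * u 0 0 * u 0 1 * w 0 0 + u 0 0 ^+ 2 * w 0 1)
  + coef p 1 2 * (u 0 1 ^+ 2 * w 0 0 + 2 * u 0 0 * u 0 1 * w 0 1)
  + 3 * coef p 0 3 * u 0 1 ^+ 2 * w 0 1).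
by move=> h; rewrite /dirder /gradx /grady !mxE; ring.
Qed.

Lemma derive_peval p x u : 'D_u (peval p) x = dirder p x u.
Proof.
rewrite /derive; apply: cvg_lim => //.
(* The difference quotient is a polynomial in its step. *)
pose f (h : R) := dirder p x u + h * (taylor2 p x u) + h ^+ 2 * taylor3 p u.
have cf : continuous f.
  move=> h; apply: cvgD; [apply: cvgD; [exact: cvg_cst|]|]; apply: cvgM;
    try exact: cvg_cst; [exact: cvg_id|exact: exprn_continuous].
have f0 : f 0 = dirder p x u by rewrite /f; ring.
rewrite -f0.
have h1 : f h @[h --> (0 : R)^'] --> f 0.
  exact: (cvg_trans (cvg_app f (@nbhs_dnbhs _ (0 : R))) (cf 0)).
apply: cvg_trans h1; apply: near_eq_cvg.
apply: filterS (nbhs_dnbhs_neq (0 : R)) => h h0 /=.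
by rewrite (addrC (h *: u)) peval_taylor /f /GRing.scale /=; field.
Qed.

End Gradient.

Section Edge.
Context {R : realType} (M : mesh R).
Local Notation plane := 'rV[R]_2.
Local Notation pos := (@pos R M).
Implicit Types (p : poly2 R 3) (a b : vertex M).

Definition midpoint a b : plane := pos a + 2^-1 *: (pos b - pos a).

(** The vector from a to b, turned by a quarter turn. It has the length of the
    edge, which spares the square root in the normal. *)
Definition edge_perp a b : plane :=
  pt (- (pos b - pos a) 0 1) ((pos b - pos a) 0 0).

Lemma edge_normalE a b :
  edge_normal a b = (enorm (pos b - pos a))^-1 *: edge_perp a b.
Proof. by rewrite /edge_normal /edge_perp; congr (_ *: _). Qed.

(** Six times the normal flux of grad p through the edge, by Simpson's rule. *)
Definition edge_flux p a b : R :=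
  dirder p (pos a) (edge_perp a b) + dirder p (pos b) (edge_perp a b)
  + 4 * dirder p (midpoint a b) (edge_perp a b).

Lemma enorm_gt0 (x : plane) : x != 0 -> 0 < enorm x.
Proof.
move=> x0; rewrite /enorm sqrtr_gt0 lt_neqAle addr_ge0 ?sqr_ge0 // andbT eq_sym.
rewrite paddr_eq0 ?sqr_ge0 // !sqrf_eq0; apply: contra x0 => /andP[/eqP h0 /eqP h1].
by apply/eqP/rV2P; rewrite mxE.
Qed.

Lemma orthogonal_eq0 (d : plane) (x y : R) : d != 0 ->
  x * d 0 0 + y * d 0 1 = 0 -> x * - d 0 1 + y * d 0 0 = 0 -> x = 0 /\ y = 0.
Proof.
move=> d0 h1 h2.
have n0 : d 0 0 ^+ 2 + d 0 1 ^+ 2 != 0.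
  by have := enorm_gt0 d0; rewrite sqrtr_gt0 lt_neqAle eq_sym => /andP[].
have e1 : x * (d 0 0 ^+ 2 + d 0 1 ^+ 2) = 0.
  transitivity (d 0 0 * (x * d 0 0 + y * d 0 1)
    - d 0 1 * (x * - d 0 1 + y * d 0 0)); first by ring.
  by rewrite h1 h2; ring.
have e2 : y * (d 0 0 ^+ 2 + d 0 1 ^+ 2) = 0.
  transitivity (d 0 1 * (x * d 0 0 + y * d 0 1)
    + d 0 0 * (x * - d 0 1 + y * d 0 0)); first by ring.
  by rewrite h1 h2; ring.
by move: e1 e2 => /eqP + /eqP; rewrite !mulf_eq0 (negbTE n0) !orbF => /eqP + /eqP.
Qed.

Lemma segE (x y : plane) (t : R) : (1 - t) *: x + t *: y = x + t *: (y - x).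
Proof. by rewrite scalerBl scale1r scalerBr addrA addrAC. Qed.

Lemma int_edge_peval p a b : int_edge a b (peval p) =
  enorm (pos b - pos a)
  * ((peval p (pos a) + 4 * peval p (midpoint a b) + peval p (pos b)) / 6).
Proof.
rewrite /int_edge; congr (_ * _).
rewrite (@simpson R _ (peval p (pos a)) (dirder p (pos a) (pos b - pos a))
  (taylor2 p (pos a) (pos b - pos a)) (taylor3 p (pos b - pos a))); last first.
  by move=> t; rewrite segE peval_taylor; ring.
by rewrite !segE scale0r addr0 scale1r (addrC (pos a) (pos b - pos a)) subrK.
Qed.

Lemma peval1_seg (q : poly2 R 1) (x u : plane) : exists c, forall t,
  peval q (x + t *: u) = peval q x + c * t.
Proof.
exists (coef q 1 0 * u 0 0 + coef q 0 1 * u 0 1) => t.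
by rewrite !peval1E !mxE; ring.
Qed.

Lemma int_edge_dirder (q : poly2 R 1) p a b w :
  int_edge a b (fun x => peval q x * dirder p x w) =
  enorm (pos b - pos a)
  * ((peval q (pos a) * dirder p (pos a) w
      + 2 * (peval q (pos a) + peval q (pos b)) * dirder p (midpoint a b) w
      + peval q (pos b) * dirder p (pos b) w) / 6).
Proof.
rewrite /int_edge; congr (_ * _).
have [c hq] := peval1_seg q (pos a) (pos b - pos a).
have [c1 [c2 hp]] := dirder_taylor p (pos a) (pos b - pos a) w.
rewrite (@simpson R _ (peval q (pos a) * dirder p (pos a) w)
  (peval q (pos a) * c1 + c * dirder p (pos a) w)
  (peval q (pos a) * c2 + c * c1) (c * c2)); last first.
  by move=> t; rewrite segE hq hp; ring.
rewrite !segE scale0r addr0 scale1r.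
have qb := hq 1; rewrite scale1r addrC subrK in qb.
have e : pos a + (pos b - pos a) = pos b by rewrite addrC subrK.
by rewrite /midpoint e hq qb; field.
Qed.

Lemma peval1_interp a b (u v : R) : pos a != pos b -> exists q : poly2 R 1,
  peval q (pos a) = u /\ peval q (pos b) = v.
Proof.
move=> ab; set d := pos b - pos a.
pose n := d 0 0 ^+ 2 + d 0 1 ^+ 2.
have n0 : n != 0.
  have := @enorm_gt0 d; rewrite subr_eq0 eq_sym => /(_ ab); rewrite sqrtr_gt0.
  by rewrite lt_neqAle eq_sym => /andP[].
pose c (i j : nat) : R := if i == 1%N then (v - u) * d 0 0 / n else
  if j == 1%N then (v - u) * d 0 1 / n else
  u - (v - u) * (d 0 0 * pos a 0 0 + d 0 1 * pos a 0 1) / n.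
(* The affine function that varies along the edge only. *)
have [q hq] := @poly2_coef R 1 c.
have bE j : pos b 0 j = pos a 0 j + d 0 j by rewrite /d !mxE; ring.
exists q; rewrite !peval1E !hq // /c /=; split; first by ring.
by rewrite !bE; move: n0; rewrite /n => n0; field.
Qed.

(** The edge conditions for a cubic that vanishes at both ends. The tangential part
    of the equality of the gradients is the vanishing of the edge mean, as the
    difference of the two end derivatives is then 8 p (m). *)
Lemma edge_condP p a b : pos a != pos b -> peval p (pos a) = 0 -> peval p (pos b) = 0 ->
  (int_edge a b (peval p) = 0 /\
   forall q : poly2 R 1, int_edge a b (fun x => peval q x * dnormal a b (peval p) x) = 0)
  <-> [/\ gradx p (pos a) = gradx p (pos b), grady p (pos a) = grady p (pos b)
        & edge_flux p a b = 0].
Proof.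
move=> ab pa pb.
have E0 : enorm (pos b - pos a) != 0.
  by rewrite gt_eqF // enorm_gt0 // subr_eq0 eq_sym.
have intE (q : poly2 R 1) : int_edge a b (fun x => peval q x * dnormal a b (peval p) x) =
  (peval q (pos a) * dirder p (pos a) (edge_perp a b)
      + 2 * (peval q (pos a) + peval q (pos b)) * dirder p (midpoint a b) (edge_perp a b)
      + peval q (pos b) * dirder p (pos b) (edge_perp a b)) / 6.
  have -> : (fun x => peval q x * dnormal a b (peval p) x) = fun x =>
      peval q x * dirder p x ((enorm (pos b - pos a))^-1 *: edge_perp a b).
    by apply/funext => x; rewrite /dnormal derive_peval edge_normalE.
  have dZ x : dirder p x ((enorm (pos b - pos a))^-1 *: edge_perp a b)
    = (enorm (pos b - pos a))^-1 * dirder p x (edge_perp a b).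
    by rewrite /dirder !mxE; ring.
  by rewrite int_edge_dirder !dZ; field.
have tang : dirder p (pos a) (pos b - pos a) - dirder p (pos b) (pos b - pos a)
    = 8 * peval p (midpoint a b).
  have -> : dirder p (pos a) (pos b - pos a) - dirder p (pos b) (pos b - pos a)
    = 8 * peval p (midpoint a b) - 4 * peval p (pos a) - 4 * peval p (pos b).
    have -> : pos b = pos a + 1 *: (pos b - pos a) by rewrite scale1r addrC subrK.
    rewrite /midpoint; set u := pos b - pos a.
    have -> : pos a + 1 *: u - pos a = u by rewrite scale1r addrC addKr.
    by rewrite !peval3E /dirder /gradx /grady !mxE; field.
  by rewrite pa pb; ring.
have gradE : dirder p (pos a) (pos b - pos a) = dirder p (pos b) (pos b - pos a) ->
    dirder p (pos a) (edge_perp a b) = dirder p (pos b) (edge_perp a b) ->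
    gradx p (pos a) = gradx p (pos b) /\ grady p (pos a) = grady p (pos b).
  rewrite /dirder /edge_perp pt0 pt1 => h1 h2.
  have d0 : pos b - pos a != 0 by rewrite subr_eq0 eq_sym.
  have [||h3 h4] := @orthogonal_eq0 _ (gradx p (pos a) - gradx p (pos b))
    (grady p (pos a) - grady p (pos b)) d0; [lra|lra|].
  by split; lra.
rewrite int_edge_peval pa pb add0r addr0; split.
  move=> [/eqP + hq]; rewrite !mulf_eq0 (negbTE E0) /= invr_eq0 !pnatr_eq0 orbF /=.
  move=> /eqP pm; rewrite pm mulr0 in tang.
  (* Test functions that vanish at one end and are 1 at the other one. *)
  have [q1 [q1a q1b]] := peval1_interp 1 0 ab.
  have [q2 [q2a q2b]] := peval1_interp 0 1 ab.
  have := hq q1; have := hq q2; rewrite !intE q1a q1b q2a q2b /edge_flux => h2 h1.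
  by have [||-> ->] := gradE; [lra|lra|split=> //; lra].
move=> [gx gy fl].
have dE w : dirder p (pos a) w = dirder p (pos b) w by rewrite /dirder gx gy.
split; first by move: tang; rewrite dE subrr => h; have -> : peval p (midpoint a b) = 0; [lra|ring].
move=> q; rewrite intE dE; move: fl; rewrite /edge_flux dE => fl.
have -> : dirder p (pos b) (edge_perp a b) = - 2 * dirder p (midpoint a b) (edge_perp a b) by lra.
by field.
Qed.

End Edge.

(** * Unisolvence on a triangle *)

Section Unisolvence.
Context {R : realType} (M : mesh R).
Local Notation plane := 'rV[R]_2.
Local Notation pos := (@pos R M).
Implicit Types (p : poly2 R 3) (a b c : vertex M).

(** The mean of the gradient along the edge vanishes: its normal part by assumption,
    its tangential part because p has the same value at both ends. Simpson's
    rule then gives the gradient at the midpoint. *)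
Lemma gradient_midpoint p a b : pos a != pos b ->
  peval p (pos a) = 0 -> peval p (pos b) = 0 ->
  gradx p (pos a) = gradx p (pos b) -> grady p (pos a) = grady p (pos b) ->
  edge_flux p a b = 0 ->
  gradx p (midpoint a b) = - gradx p (pos a) / 2 /\
  grady p (midpoint a b) = - grady p (pos a) / 2.
Proof.
move=> ab pa pb gx gy.
have d0 : pos b - pos a != 0 by rewrite subr_eq0 eq_sym.
have : dirder p (pos a) (pos b - pos a) + dirder p (pos b) (pos b - pos a)
    + 4 * dirder p (midpoint a b) (pos b - pos a) = 0.
  transitivity (6 * (peval p (pos b) - peval p (pos a))); last by rewrite pa pb; ring.
  have -> : pos b = pos a + 1 *: (pos b - pos a) by rewrite scale1r addrC subrK.
  rewrite /midpoint; set u := pos b - pos a.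
  have -> : pos a + 1 *: u - pos a = u by rewrite scale1r addrC addKr.
  by rewrite !peval3E /dirder /gradx /grady !mxE; field.
rewrite /edge_flux /dirder /edge_perp pt0 pt1 gx gy => h1 h2.
have [||h3 h4] := @orthogonal_eq0 R _
  (2 * gradx p (pos b) + 4 * gradx p (midpoint a b))
  (2 * grady p (pos b) + 4 * grady p (midpoint a b)) d0; [lra|lra|].
by split; lra.
Qed.

Lemma peval_eq0 p : (forall x : plane, peval p x = 0) -> p = 0.
Proof.
move=> h.
have c0 i j : coef (0 : poly2 R 3) i j = 0.
  by rewrite -[0 in LHS](scale0r (0 : poly2 R 3)) coefZ mul0r.
(* A set of ten points at which no nonzero cubic vanishes. *)
have e00 := h (pt 0 0); have e10 := h (pt 1 0); have e20 := h (pt (-1) 0).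
have e30 := h (pt 2 0); have e01 := h (pt 0 1); have e02 := h (pt 0 (-1)).
have e03 := h (pt 0 2); have e11 := h (pt 1 1); have e21 := h (pt (-1) 1).
have e12 := h (pt 1 (-1)).
move: e00 e10 e20 e30 e01 e02 e03 e11 e21 e12; rewrite !peval3E !pt0 !pt1.
move=> e00 e10 e20 e30 e01 e02 e03 e11 e21 e12.
apply: coef_inj => i j; rewrite c0.
by case: i => [|[|[|[|i]]]]; case: j => [|[|[|[|j]]]] // _; lra.
Qed.

(** taylor11 and taylor21 are the coefficients of s t and of s^2 t in
    p (x + s u + t v). *)
Definition taylor11 p (x u v : plane) : R :=
  2 * coef p 2 0 * u 0 0 * v 0 0 + coef p 1 1 * (u 0 0 * v 0 1 + u 0 1 * v 0 0)
  + 2 * coef p 0 2 * u 0 1 * v 0 1 + 6 * coef p 3 0 * x 0 0 * u 0 0 * v 0 0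
  + 2 * coef p 2 1 * (x 0 0 * (u 0 0 * v 0 1 + u 0 1 * v 0 0) + x 0 1 * u 0 0 * v 0 0)
  + 2 * coef p 1 2 * (x 0 1 * (u 0 0 * v 0 1 + u 0 1 * v 0 0) + x 0 0 * u 0 1 * v 0 1)
  + 6 * coef p 0 3 * x 0 1 * u 0 1 * v 0 1.

Definition taylor21 p (u v : plane) : R :=
  3 * coef p 3 0 * u 0 0 ^+ 2 * v 0 0
  + coef p 2 1 * (u 0 0 ^+ 2 * v 0 1 + 2 * u 0 0 * u 0 1 * v 0 0)
  + coef p 1 2 * (u 0 1 ^+ 2 * v 0 0 + 2 * u 0 0 * u 0 1 * v 0 1)
  + 3 * coef p 0 3 * u 0 1 ^+ 2 * v 0 1.

Lemma peval_taylor_2 p x u v s t : peval p (x + s *: u + t *: v) =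
  peval p x + s * dirder p x u + t * dirder p x v
  + s ^+ 2 * taylor2 p x u + s * t * taylor11 p x u v + t ^+ 2 * taylor2 p x v
  + s ^+ 3 * taylor3 p u + s ^+ 2 * t * taylor21 p u v
  + s * t ^+ 2 * taylor21 p v u + t ^+ 3 * taylor3 p v.
Proof.
rewrite !peval3E /dirder /gradx /grady /taylor2 /taylor3 /taylor11 /taylor21 !mxE.
by ring.
Qed.

Lemma dirder_taylor_2 p x u v s t : dirder p (x + s *: u + t *: v) u =
  dirder p x u + 2 * s * taylor2 p x u + t * taylor11 p x u v
  + 3 * s ^+ 2 * taylor3 p u + 2 * s * t * taylor21 p u v
  + t ^+ 2 * taylor21 p v u.
Proof.
rewrite /dirder /gradx /grady /taylor2 /taylor3 /taylor11 /taylor21 !mxE.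
by ring.
Qed.

Lemma taylor11C p x u v : taylor11 p x u v = taylor11 p x v u.
Proof. by rewrite /taylor11; ring. Qed.

(** In the affine coordinates s and t for which the vertices are (0,0), (1,0) and
    (0,1), the ten Taylor coefficients of p at a solve a linear system with
    numerical coefficients. The gradient of p would be a constant vector times a
    quadratic bubble, and equality of the mixed derivatives makes it vanish. *)
Lemma unisolvent p a b c :
  cross (pos b - pos a) (pos c - pos a) != 0 ->
  peval p (pos a) = 0 -> peval p (pos b) = 0 -> peval p (pos c) = 0 ->
  gradx p (pos a) = gradx p (pos b) -> grady p (pos a) = grady p (pos b) ->
  gradx p (pos a) = gradx p (pos c) -> grady p (pos a) = grady p (pos c) ->
  edge_flux p a b = 0 -> edge_flux p a c = 0 -> edge_flux p b c = 0 ->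
  p = 0.
Proof.
move=> D pa pb pc gxb gyb gxc gyc fab fac fbc.
have ab : pos a != pos b.
  by apply: contra_neq D => ->; rewrite /cross !mxE; ring.
have ac : pos a != pos c.
  by apply: contra_neq D => ->; rewrite /cross !mxE; ring.
have bc : pos b != pos c.
  by apply: contra_neq D => ->; rewrite /cross !mxE; ring.
have [mabx maby] := gradient_midpoint ab pa pb gxb gyb fab.
have [macx macy] := gradient_midpoint ac pa pc gxc gyc fac.
have [mbcx mbcy] : gradx p (midpoint b c) = - gradx p (pos b) / 2 /\
    grady p (midpoint b c) = - grady p (pos b) / 2.
  by apply: gradient_midpoint => //; [rewrite -gxb -gxc|rewrite -gyb -gyc].
set u := pos b - pos a in D; set v := pos c - pos a in D.
set x := pos a in D *.
have bE : pos b = x + 1 *: u + 0 *: v.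
  by rewrite scale1r scale0r addr0 addrC subrK.
have cE : pos c = x + 0 *: u + 1 *: v.
  by rewrite scale1r scale0r addr0 addrC subrK.
have mab : midpoint a b = x + 2^-1 *: u + 0 *: v by rewrite scale0r addr0.
have mac : midpoint a c = x + 0 *: u + 2^-1 *: v by rewrite scale0r addr0.
have mbc : midpoint b c = x + 2^-1 *: u + 2^-1 *: v.
  by apply: rV2P; rewrite /midpoint /u /v /x !mxE; field.
rewrite bE in gxb gyb mbcx mbcy; rewrite cE in gxc gyc.
rewrite mab in mabx maby; rewrite mac in macx macy; rewrite mbc in mbcx mbcy.
have swap (s t : R) : x + s *: u + t *: v = x + t *: v + s *: u by rewrite addrAC.
have dE w y1 y2 (k : R) : gradx p y1 = k * gradx p y2 -> grady p y1 = k * grady p y2 ->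
    dirder p y1 w = k * dirder p y2 w.
  by rewrite /dirder => -> ->; ring.
have half (y : R) : - y / 2 = (- 2^-1) * y by field.
rewrite half -gxb in mbcx; rewrite half -gyb in mbcy.
rewrite half in mabx; rewrite half in maby; rewrite half in macx; rewrite half in macy.
have one (y z : R) : y = z -> z = 1 * y by move=> ->; rewrite mul1r.
have hb w := dE w _ _ _ (one _ _ gxb) (one _ _ gyb).
have hc w := dE w _ _ _ (one _ _ gxc) (one _ _ gyc).
have hab w := dE w _ _ _ mabx maby.
have hac w := dE w _ _ _ macx macy.
have hbc w := dE w _ _ _ mbcx mbcy.
have := (hb u, hc u, hab u, hac u, hbc u); rewrite !dirder_taylor_2.
have := (hb v, hc v, hab v, hac v, hbc v); rewrite !swap !dirder_taylor_2.
rewrite (taylor11C p x v u).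
move=> [[[[v1 v2] v3] v4] v5] [[[[u1 u2] u3] u4] u5].
have du : dirder p x u = 0 by lra.
have dv : dirder p x v = 0 by lra.
rewrite ?du ?dv in v1 v2 v3 v4 v5 u1 u2 u3 u4 u5.
have z1 : taylor2 p x u = 0 by lra.
have z2 : taylor2 p x v = 0 by lra.
have z3 : taylor11 p x u v = 0 by lra.
have z4 : taylor21 p u v = 0 by lra.
have z5 : taylor21 p v u = 0 by lra.
have z6 : taylor3 p u = 0 by lra.
have z7 : taylor3 p v = 0 by lra.
apply: peval_eq0 => y.
have -> : y = x + (cross (y - x) v / cross u v) *: u
            + (cross u (y - x) / cross u v) *: v.
  move: D; rewrite /cross => D.
  by apply: rV2P; move: D; rewrite !mxE => D; field.
by rewrite peval_taylor_2 pa du dv z1 z2 z3 z4 z5 z6 z7; ring.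
Qed.

End Unisolvence.

(** * Local degrees of freedom *)

(** Any finite sequence contains a basis of its span. *)
Lemma subseq_basis (K : fieldType) (vT : vectType K) (s : seq vT) :
  exists b : seq vT, {subset b <= s} /\ basis_of (span s) b.
Proof.
elim: s => [|x s [b [bs /andP[/eqP bE fb]]]].
  by exists [::]; rewrite span_nil nil_basis.
have [xs|xs] := boolP (x \in span s).
  exists b; split; first by move=> y /bs; rewrite inE => ->; rewrite orbT.
  have -> : span (x :: s) = span s by rewrite span_cons; apply/addv_idPr.
  by rewrite /basis_of bE eqxx.
exists (x :: b); split.
  by move=> y; rewrite !inE => /orP[->//|/bs ->]; rewrite orbT.
by rewrite /basis_of !span_cons bE eqxx free_cons bE xs fb.
Qed.

Lemma card_monomial3 : #|{: monomial 3}| = 10%N.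
Proof.
rewrite card_sig -sum1_card big_mkcond /=.
rewrite -(pair_big xpredT xpredT (fun i j : 'I_4 => if (i + j <= 3)%N then 1%N else 0%N)) /=.
by rewrite !big_ord_recr !big_ord0.
Qed.

Lemma ffun_dim (R : realType) (I : finType) : dim {ffun I -> R^o} = #|I|.
Proof. exact: muln1. Qed.

Section Dofs.
Context {R : realType} (M : mesh R).
Local Notation plane := 'rV[R]_2.
Local Notation pos := (@pos R M).
Implicit Types (p : poly2 R 3) (a b c : vertex M) (T : {set vertex M}).

(** The index set of the parameters: at a vertex a, indices 0, 1, 2 stand for the
    value and for the two components of the vector g(a); a pair (a, b) of
    vertices stands for the edge ab. *)
Definition dof : Type := (vertex M * 'I_3 + vertex M * vertex M)%type.

Lemma edge_fluxD p q a b : edge_flux (p + q) a b = edge_flux p a b + edge_flux q a b.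
Proof. by rewrite /edge_flux /dirder !gradxD !gradyD; ring. Qed.

Lemma edge_fluxZ k p a b : edge_flux (k *: p) a b = k * edge_flux p a b.
Proof. by rewrite /edge_flux /dirder !gradxZ !gradyZ; ring. Qed.

Lemma edge_fluxB p q a b : edge_flux (p - q) a b = edge_flux p a b - edge_flux q a b.
Proof. by rewrite -scaleN1r edge_fluxD edge_fluxZ mulN1r. Qed.

Lemma edge_fluxC p a b : edge_flux p b a = - edge_flux p a b.
Proof.
have -> : edge_flux p b a = dirder p (pos b) (edge_perp b a) +
    dirder p (pos a) (edge_perp b a) + 4 * dirder p (midpoint a b) (edge_perp b a).
  by congr (_ + 4 * dirder p _ _); apply: rV2P; rewrite /midpoint !mxE; field.
by rewrite /edge_flux /dirder /edge_perp !pt0 !pt1 !mxE; ring.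
Qed.

Lemma edge_flux_refl p a : edge_flux p a a = 0.
Proof. by have := edge_fluxC p a a; lra. Qed.

(** The cubic p has the data f on the triangle T: the vectors g(a) only matter
    through their differences. The flux depends on the difference of the
    parameters of (a, b) and (b, a), as it changes sign with the orientation of
    the edge. *)
Definition agree p (f : dof -> R) T : Prop :=
  [/\ forall a, a \in T -> peval p (pos a) = f (inl (a, 0)),
      forall a b, a \in T -> b \in T ->
        gradx p (pos b) - gradx p (pos a) = f (inl (b, 1)) - f (inl (a, 1)),
      forall a b, a \in T -> b \in T ->
        grady p (pos b) - grady p (pos a) = f (inl (b, 2)) - f (inl (a, 2))
    & forall a b, a \in T -> b \in T ->
        edge_flux p a b = f (inr (a, b)) - f (inr (b, a))].

Lemma agreeD k p q f g T : agree p f T -> agree q g T ->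
  agree (k *: p + q) (fun j => k * f j + g j) T.
Proof.
move=> [p1 p2 p3 p4] [q1 q2 q3 q4]; split.
- by move=> a aT; rewrite pevalD pevalZ p1 ?q1.
- move=> a b aT bT; rewrite !gradxD !gradxZ.
  by have := p2 a b aT bT; have := q2 a b aT bT; nra.
- move=> a b aT bT; rewrite !gradyD !gradyZ.
  by have := p3 a b aT bT; have := q3 a b aT bT; nra.
- move=> a b aT bT; rewrite edge_fluxD edge_fluxZ p4 ?q4 //; ring.
Qed.

Lemma agree0 T : agree 0 (fun=> 0) T.
Proof.
have e0 : 0 = 0 *: (0 : poly2 R 3) by rewrite scale0r.
split=> *; rewrite e0 ?pevalZ ?gradxZ ?gradyZ ?edge_fluxZ; ring.
Qed.

Lemma eq_agree p f g T : f =1 g -> agree p f T -> agree p g T.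
Proof. by move=> /funext ->. Qed.

Section Triangle.
Variable T : {set vertex M}.
Hypothesis T3 : #|T| = 3%N.
Hypothesis injp : injective pos.
Hypothesis intT : (elt T)° !=set0.

Lemma agree_eq0 p : agree p (fun=> 0) T -> p = 0.
Proof.
move=> [p1 p2 p3 p4].
have /finset.set0Pn[c cT] : T != finset.set0 by rewrite -card_gt0 T3.
have [a [b [ab ac bc TE]]] := set3_of_mem T3 cT.
have aT : a \in T by rewrite TE !inE eqxx.
have bT : b \in T by rewrite TE !inE eqxx orbT.
apply: (@unisolvent R M p a b c); rewrite ?p1 ?p4 ?subrr //.
- apply: hull_interior_cross => //; first by apply: contra_neq ab => /injp.
  by rewrite -TE.
- by have := p2 a b aT bT; lra.
- by have := p3 a b aT bT; lra.
- by have := p2 a c aT cT; lra.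
- by have := p3 a c aT cT; lra.
Qed.

Lemma agree_unique p q f : agree p f T -> agree q f T -> p = q.
Proof.
move=> hp hq; apply/eqP; rewrite -subr_eq0; apply/eqP/agree_eq0.
have := agreeD (-1) hq hp; rewrite scaleN1r addrC.
by apply: eq_agree => j; ring.
Qed.

(** Ten linear functionals with no common zero but 0 on a space of dimension 10
    take arbitrary values. *)
Lemma agree_exists f : exists p, agree p f T.
Proof.
have /finset.set0Pn[c cT] : T != finset.set0 by rewrite -card_gt0 T3.
have [a [b [ab ac bc TE]]] := set3_of_mem T3 cT.
pose L p : {ffun 'I_10 -> R^o} := [ffun i : 'I_10 => nth (0 : R^o)
  [:: peval p (pos a); peval p (pos b); peval p (pos c);
      gradx p (pos b) - gradx p (pos a); grady p (pos b) - grady p (pos a);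
      gradx p (pos c) - gradx p (pos a); grady p (pos c) - grady p (pos a);
      edge_flux p a b; edge_flux p a c; edge_flux p b c] i].
have linL : linear L.
  move=> k p q; apply/ffunP => -[i hi]; rewrite !ffunE /=.
  case: i hi => [|[|[|[|[|[|[|[|[|[|i]]]]]]]]]] hi //=;
  rewrite ?pevalD ?pevalZ ?gradxD ?gradxZ ?gradyD ?gradyZ ?edge_fluxD ?edge_fluxZ
    /GRing.scale /=; ring.
pose LL : {linear poly2 R 3 -> {ffun 'I_10 -> R^o}} :=
  HB.pack L (GRing.isLinear.Build _ _ _ _ L linL).
have T_ind (P : vertex M -> Prop) : P a -> P b -> P c -> forall v, v \in T -> P v.
  by move=> Pa Pb Pc v; rewrite TE !inE => /orP[/orP[|]|] /eqP ->.
pose y (f : dof -> R) : {ffun 'I_10 -> R^o} := [ffun i : 'I_10 => nth (0 : R^o)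
  [:: f (inl (a, 0)); f (inl (b, 0)); f (inl (c, 0));
      f (inl (b, 1)) - f (inl (a, 1)); f (inl (b, 2)) - f (inl (a, 2));
      f (inl (c, 1)) - f (inl (a, 1)); f (inl (c, 2)) - f (inl (a, 2));
      f (inr (a, b)) - f (inr (b, a)); f (inr (a, c)) - f (inr (c, a));
      f (inr (b, c)) - f (inr (c, b))] i].
have LP p g : L p = y g -> agree p g T.
  move=> /ffunP h.
  have e i (hi : (i < 10)%N) := h (Ordinal hi).
  have e0 := e 0%N isT; have e1 := e 1%N isT; have e2 := e 2%N isT.
  have e3 := e 3%N isT; have e4 := e 4%N isT; have e5 := e 5%N isT.
  have e6 := e 6%N isT; have e7 := e 7%N isT; have e8 := e 8%N isT.
  have e9 := e 9%N isT; clear e h.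
  rewrite !ffunE /= in e0 e1 e2 e3 e4 e5 e6 e7 e8 e9.
  split.
  - by apply: (T_ind).
  - by move=> u v uT vT; move: u uT v vT; apply: (T_ind); apply: (T_ind); lra.
  - by move=> u v uT vT; move: u uT v vT; apply: (T_ind); apply: (T_ind); lra.
  - move=> u v uT vT; move: u uT v vT; apply: (T_ind); apply: (T_ind);
      rewrite ?edge_flux_refl ?(edge_fluxC p a b) ?(edge_fluxC p a c) ?(edge_fluxC p b c);
      lra.
have ker0 : lker (linfun LL) == 0%VS.
  rewrite -subv0; apply/subvP => p; rewrite memv_ker lfunE /= => /eqP Lp.
  rewrite memv0; apply/eqP/agree_eq0/LP; rewrite Lp.
  by apply/ffunP => -[i hi]; rewrite !ffunE /=;
    case: i hi => [|[|[|[|[|[|[|[|[|[|i]]]]]]]]]] hi //=; rewrite ?subrr.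
have full : limg (linfun LL) = fullv.
  apply/eqP; rewrite eqEdim subvf limg_dim_eq; last by rewrite (eqP ker0) capv0.
  by rewrite !dimvf !ffun_dim card_ord card_monomial3.
have : y f \in limg (linfun LL) by rewrite full memvf.
by move=> /memv_imgP[p _ hp]; exists p; apply: LP; rewrite hp lfunE.
Qed.

End Triangle.
End Dofs.

(** * The vertex-patch basis *)

Section Assembly.
Context {R : realType} (M : mesh R) (Omega : set 'rV[R]_2).
Local Notation plane := 'rV[R]_2.
Local Notation pos := (@pos R M).
Local Notation dof := (dof M).
Implicit Types (v : P3h M) (T : triangle M) (a b c : vertex M) (f : dof -> R).
Hypothesis HOmega : polygonal_domain Omega.
Hypothesis Hsc : simply_connected Omega.
Hypothesis HM : triangulation M Omega.

Let injp : injective pos. Proof. by have [] := HM. Qed.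

Let tri3 T : #|val T| = 3%N.
Proof. by have [_ _ h _ _] := HM; have [] := h _ (valP T). Qed.

Let tri_int T : (elt (val T))° !=set0.
Proof. by have [_ _ h _ _] := HM; have [] := h _ (valP T). Qed.

(** The parameters attached to boundary vertices and edges, taken to be 0 for
    members of B3h0. *)
Definition on_boundary (j : dof) : Prop :=
  match j with
  | inl (a, _) => boundary_vertex Omega a
  | inr (a, b) => boundary_edge Omega a b
  end.

Lemma boundary_edge_sym a b : boundary_edge Omega a b -> boundary_edge Omega b a.
Proof.
move=> [[ab [T hT abT]] h]; split; last by rewrite finset.setUC.
by split; [rewrite eq_sym|exists T; rewrite // finset.setUC].
Qed.

Lemma boundary_edge_vertex a b : boundary_edge Omega a b -> boundary_vertex Omega a.
Proof.
move=> [[ab _] h]; apply: h.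
exists (fun x => (x == a)%:R); split.
- by move=> x _; rewrite ler0n.
- by rewrite big_setU1 ?inE //= big_set1 eqxx eq_sym (negbTE ab) addr0.
- by rewrite big_setU1 ?inE //= big_set1 eqxx eq_sym (negbTE ab) scale1r scale0r addr0.
Qed.

Lemma jump_restr v T T' : jump (restr v) T T' = peval (v T - v T').
Proof. by apply/funext => x; rewrite pevalB. Qed.

Lemma jump_dnormal v T T' a b :
  jump (fun K => dnormal a b (restr v K)) T T' = dnormal a b (peval (v T - v T')).
Proof.
apply/funext => x; rewrite /jump /dnormal /restr !derive_peval.
by rewrite /dirder gradxB gradyB; ring.
Qed.

Lemma is_edge_triangle T a b : a != b -> a \in val T -> b \in val T -> is_edge a b.
Proof.
move=> ab aT bT; split=> //; exists (val T); first exact: valP.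
by apply/fintype.subsetP => x; rewrite !inE => /orP[|] /eqP ->.
Qed.

Lemma pos_neq a b : a != b -> pos a != pos b.
Proof. by apply: contra_neq => /injp. Qed.

Lemma set2_sub (A : {set vertex M}) a b : ([set a; b]%SET \subset A) = (a \in A) && (b \in A).
Proof. by rewrite finset.subUset !finset.sub1set. Qed.

(** The gradient differences and the fluxes of a member of B3h0 do not depend on
    the triangle in which they are computed. *)
Lemma B3h0_match v T T' a b : B3h0 Omega v ->
  a \in val T -> b \in val T -> a \in val T' -> b \in val T' ->
  [/\ gradx (v T) (pos b) - gradx (v T) (pos a) = gradx (v T') (pos b) - gradx (v T') (pos a),
      grady (v T) (pos b) - grady (v T) (pos a) = grady (v T') (pos b) - grady (v T') (pos a)
    & edge_flux (v T) a b = edge_flux (v T') a b].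
Proof.
move=> [[vC vI] vB0 vB] aT bT aT' bT'.
have [->|ab] := eqVneq a b; first by rewrite !subrr !edge_flux_refl.
have eab := is_edge_triangle ab aT bT.
suff [h1 h2 h3] : [/\ gradx (v T - v T') (pos a) = gradx (v T - v T') (pos b),
   grady (v T - v T') (pos a) = grady (v T - v T') (pos b)
   & edge_flux (v T - v T') a b = 0].
  move: h1 h2 h3; rewrite edge_fluxB !gradxB !gradyB.
  by move=> h1 h2 h3; split; lra.
have z c : c \in val T -> c \in val T' -> peval (v T - v T') (pos c) = 0.
  by move=> cT cT'; rewrite pevalB; apply/eqP; rewrite subr_eq0; apply/eqP/vC.
apply/(edge_condP (pos_neq ab) (z _ aT aT') (z _ bT bT')).
have [bd|nbd] := pselect (elt [set a; b]%SET `<=` frontier Omega); last first.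
  have [||h1 h2] := vI a b (conj eab nbd) T T'; rewrite ?set2_sub ?aT ?bT ?aT' ?bT' //.
  by rewrite jump_restr in h1; split=> // q; move: (h2 q); rewrite jump_dnormal.
have be : boundary_edge Omega a b by split.
have za c (K : triangle M) : c = a \/ c = b -> c \in val K -> peval (v K) (pos c) = 0.
  move=> [->|->] cK; apply: (vB0 _ K) cK; first exact: boundary_edge_vertex be.
  exact: boundary_edge_vertex (boundary_edge_sym be).
have h (K : triangle M) : a \in val K -> b \in val K ->
    [/\ gradx (v K) (pos a) = gradx (v K) (pos b),
        grady (v K) (pos a) = grady (v K) (pos b) & edge_flux (v K) a b = 0].
  move=> aK bK.
  apply/(edge_condP (pos_neq ab) (za _ _ (or_introl erefl) aK) (za _ _ (or_intror erefl) bK)).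
  by apply: (vB a b be K); rewrite set2_sub aK bK.
have [h1 h2 h3] := h _ aT bT; have [h1' h2' h3'] := h _ aT' bT'.
apply/(edge_condP (pos_neq ab) (z _ aT aT') (z _ bT bT')).
by rewrite edge_fluxB !gradxB !gradyB;
  split; rewrite ?h1 ?h2 ?h3 ?h1' ?h2' ?h3' //; ring.
Qed.

Lemma B3h0_boundary v T a b : B3h0 Omega v -> boundary_edge Omega a b ->
  a \in val T -> b \in val T ->
  [/\ gradx (v T) (pos b) - gradx (v T) (pos a) = 0,
      grady (v T) (pos b) - grady (v T) (pos a) = 0
    & edge_flux (v T) a b = 0].
Proof.
move=> [_ vB0 vB] be aT bT; have [[ab _] _] := be.
have pa : peval (v T) (pos a) = 0 by apply: (vB0 a) => //; exact: boundary_edge_vertex be.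
have pb : peval (v T) (pos b) = 0.
  by apply: (vB0 b) => //; exact: boundary_edge_vertex (boundary_edge_sym be).
have /(edge_condP (pos_neq ab) pa pb)[h1 h2 h3] : int_edge a b (peval (v T)) = 0 /\
   forall q : poly2 R 1, int_edge a b (fun x => peval q x * dnormal a b (peval (v T)) x) = 0.
  by apply: vB => //; rewrite set2_sub aT bT.
by split; rewrite ?h1 ?h2 ?subrr.
Qed.

(** A quantity computed in triangles satisfying P, and independent of the triangle,
    has a value. *)
Lemma single_valued (P : triangle M -> Prop) (g : triangle M -> R) :
  (forall T T', P T -> P T' -> g T = g T') -> exists k, forall T, P T -> g T = k.
Proof.
move=> h; have [[T0 PT0]|nP] := pselect (exists T, P T).
  by exists (g T0) => T PT; exact: h.
by exists 0 => T PT; case: nP; exists T.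
Qed.

(** Every member of B3h0 comes from parameters that vanish on the boundary; the
    vectors g(a) are provided by the exactness of the cochain of gradient
    differences. *)
Lemma B3h0_data v : B3h0 Omega v -> exists f : dof -> R,
  (forall j, on_boundary j -> f j = 0) /\ forall T, agree (v T) f (val T).
Proof.
move=> hv; have [[vC _] vB0 _] := hv.
have [_ cover _ _ _] := HM.
have hasT a : exists T : triangle M, a \in val T.
  by have [T hT aT] := cover a; exists (exist _ T hT).
have /choice[V hV] : forall a, exists k, forall T, a \in val T -> peval (v T) (pos a) = k.
  by move=> a; apply: single_valued => T T'; exact: vC.
pose on2 (ab : vertex M * vertex M) T := ab.1 \in val T /\ ab.2 \in val T.
have /choice[dx hdx] : forall ab, exists k, forall T, on2 ab T ->
    gradx (v T) (pos ab.2) - gradx (v T) (pos ab.1) = k.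
  move=> [a b]; apply: single_valued => T T' /= [aT bT] [aT' bT'].
  by have [] := B3h0_match hv aT bT aT' bT'.
have /choice[dy hdy] : forall ab, exists k, forall T, on2 ab T ->
    grady (v T) (pos ab.2) - grady (v T) (pos ab.1) = k.
  move=> [a b]; apply: single_valued => T T' /= [aT bT] [aT' bT'].
  by have [] := B3h0_match hv aT bT aT' bT'.
have /choice[n hn] : forall ab, exists k, forall T, on2 ab T ->
    edge_flux (v T) ab.1 ab.2 = k.
  move=> [a b]; apply: single_valued => T T' /= [aT bT] [aT' bT'].
  by have [] := B3h0_match hv aT bT aT' bT'.
have edgeT a b : boundary_edge Omega a b -> exists2 T : triangle M, a \in val T & b \in val T.
  by move=> [[_ [T hT]]]; rewrite set2_sub => /andP[aT bT] _; exists (exist _ T hT).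
have exact_grad (d : vertex M * vertex M -> R) (g : triangle M -> vertex M -> R) :
    (forall ab T, on2 ab T -> g T ab.2 - g T ab.1 = d ab) ->
    (forall a b, boundary_edge Omega a b -> d (a, b) = 0) ->
    exists2 G : vertex M -> R, forall a, boundary_vertex Omega a -> G a = 0 &
      forall a b T, a \in val T -> b \in val T -> d (a, b) = G b - G a.
  move=> hd db.
  have [||G G0 hG] := @cochain_exact R Omega M (fun a b => d (a, b)) HOmega Hsc HM.
  - move=> T a b c hT aT bT cT; pose K : triangle M := exist _ T hT.
    rewrite -(hd (a, b) K) // -(hd (b, c) K) // -(hd (a, c) K) //=; ring.
  - exact: db.
  by exists G => // a b T aT bT; apply: (hG (val T)) => //; exact: valP.
have [gx gx0 hgx] : exists2 G : vertex M -> R, forall a, boundary_vertex Omega a -> G a = 0 &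
      forall a b T, a \in val T -> b \in val T -> dx (a, b) = G b - G a.
  apply: (exact_grad dx (fun T a => gradx (v T) (pos a))) => [ab T|a b be]; first exact: hdx.
  have [T aT bT] := edgeT _ _ be; rewrite -(hdx (a, b) T) //.
  by have [] := B3h0_boundary hv be aT bT.
have [gy gy0 hgy] : exists2 G : vertex M -> R, forall a, boundary_vertex Omega a -> G a = 0 &
      forall a b T, a \in val T -> b \in val T -> dy (a, b) = G b - G a.
  apply: (exact_grad dy (fun T a => grady (v T) (pos a))) => [ab T|a b be]; first exact: hdy.
  have [T aT bT] := edgeT _ _ be; rewrite -(hdy (a, b) T) //.
  by have [] := B3h0_boundary hv be aT bT.
(* Half of the flux, as the flux is the difference of the parameters of
   (a, b) and (b, a). *)
pose f (j : dof) : R := match j with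
  | inl (a, i) => if i == 0 then V a else if i == 1 then gx a else gy a
  | inr (a, b) => n (a, b) / 2
  end.
exists f; split.
  move=> [[a i]|[a b]] /= bd.
    case: ifP => _; last by case: ifP => _; [exact: gx0|exact: gy0].
    by have [T aT] := hasT a; rewrite -(hV a T) //; exact: (vB0 a T).
  have [T aT bT] := edgeT _ _ bd; rewrite -(hn (a, b) T) //=.
  by have [_ _ ->] := B3h0_boundary hv bd aT bT; rewrite mul0r.
move=> T; split=> [a aT|a b aT bT|a b aT bT|a b aT bT] /=.
- exact: hV.
- by rewrite -(hgx a b T) // -(hdx (a, b) T).
- by rewrite -(hgy a b T) // -(hdy (a, b) T).
- rewrite -(hn (a, b) T) // -(hn (b, a) T) //= (edge_fluxC _ a b); lra.
Qed.

Lemma B3h0_of_data v f : (forall j, on_boundary j -> f j = 0) ->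
  (forall T, agree (v T) f (val T)) -> B3h0 Omega v.
Proof.
move=> f0 hf.
have diff T T' a b : a != b -> a \in val T -> b \in val T -> a \in val T' -> b \in val T' ->
  int_edge a b (peval (v T - v T')) = 0 /\
   forall q : poly2 R 1, int_edge a b (fun x => peval q x * dnormal a b (peval (v T - v T')) x) = 0.
  move=> ab aT bT aT' bT'; have [p1 p2 p3 p4] := hf T; have [q1 q2 q3 q4] := hf T'.
  apply/edge_condP; rewrite ?pevalB ?p1 ?q1 ?subrr ?pos_neq //.
  have := p2 a b aT bT; have := p3 a b aT bT; have := p4 a b aT bT.
  have := q2 a b aT' bT'; have := q3 a b aT' bT'; have := q4 a b aT' bT'.
  rewrite edge_fluxB !gradxB !gradyB.
  by move=> -> ? ? -> ? ?; split; lra.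
have vB0 a T : boundary_vertex Omega a -> a \in val T -> peval (v T) (pos a) = 0.
  by move=> bd aT; have [-> // _ _ _] := hf T; exact: f0.
split=> //.
- split.
    by move=> a T T' aT aT'; rewrite /restr; have [-> // _ _ _] := hf T; have [-> // _ _ _] := hf T'.
  move=> a b [[ab _] _] T T'; rewrite !set2_sub => /andP[aT bT] /andP[aT' bT'].
  have [h1 h2] := diff T T' a b ab aT bT aT' bT'.
  by rewrite jump_restr; split=> // q; rewrite jump_dnormal; exact: h2.
- move=> a b be T; rewrite set2_sub => /andP[aT bT].
  have [[ab _] _] := be; have [p1 p2 p3 p4] := hf T.
  have bda := boundary_edge_vertex be.
  have bdb := boundary_edge_vertex (boundary_edge_sym be).
  have := p2 a b aT bT; have := p3 a b aT bT; have := p4 a b aT bT.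
  have fa i : f (inl (a, i)) = 0 by exact: f0.
  have fb i : f (inl (b, i)) = 0 by exact: f0.
  have fab : f (inr (a, b)) = 0 by exact: f0.
  have fba : f (inr (b, a)) = 0 by apply: f0; exact: boundary_edge_sym be.
  rewrite !fa !fb fab fba !subrr => e1 e2 e3.
  apply/edge_condP; rewrite ?vB0 ?pos_neq //.
  by split => //; lra.
Qed.

(** The parameters can be prescribed freely, because each triangle can be treated
    separately: the continuity conditions follow from the use of common data. *)
Lemma interpolant f : exists v, forall T, agree (v T) f (val T).
Proof.
have /choice[p hp] : forall T, exists p, agree p f (val T).
  by move=> T; exact: (agree_exists (tri3 T) injp (tri_int T)).
by exists [ffun T => p T] => T; rewrite ffunE.
Qed.

Lemma B3h0_scaleD k v w : B3h0 Omega v -> B3h0 Omega w -> B3h0 Omega (k *: v + w).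
Proof.
move=> /B3h0_data[f [f0 hf]] /B3h0_data[g [g0 hg]].
apply: (@B3h0_of_data _ (fun j => k * f j + g j)) => [j bj|T].
  by rewrite f0 // g0 // mulr0 addr0.
by rewrite !ffunE; exact: agreeD.
Qed.

Lemma B3h0_0 : B3h0 Omega (0 : P3h M).
Proof.
apply: (@B3h0_of_data _ (fun=> 0)) => // T.
by rewrite ffunE; exact: agree0.
Qed.

End Assembly.

Theorem theorem28 (R : realType) (Omega : set 'rV[R]_2) (M : mesh R) (sigma : R)
    (HOmega : polygonal_domain Omega) (Hsc : simply_connected Omega)
    (HM : triangulation M Omega) (Hreg : shape_regular M sigma) :
  exists (B : {vspace P3h M}) (b : seq (P3h M)),
    (forall v : P3h M, (v \in B) <-> B3h0 Omega v) /\
    basis_of B b /\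
    (forall v : P3h M, v \in b -> exists a : vertex M, supported_in v (vertex_patch a)).
Proof.
pose unit_dof (j i : dof M) : R := (i == j)%:R.
have /choice[phi hphi] : forall j, exists v : P3h M,
    forall T, agree (v T) (unit_dof j) (val T).
  by move=> j; exact: (interpolant HM).
pose gens := [seq phi j | j <- [seq j <- enum {: dof M}
  | ~~ `[< on_boundary Omega j >]]].
have phiB j : ~ on_boundary Omega j -> B3h0 Omega (phi j).
  move=> nbj; apply: (B3h0_of_data HM (f := unit_dof j)) (hphi j) => i bi.
  by rewrite /unit_dof; case: eqP => // ij; rewrite ij in bi.
have gensP v : v \in gens -> exists2 j, ~ on_boundary Omega j & v = phi j.
  by move=> /mapP[j]; rewrite mem_filter => /andP[/asboolPn nbj _] ->; exists j.
have [b [bg bB]] := subseq_basis gens.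
have tri (T : triangle M) : #|val T| = 3%N /\ (elt (val T))° !=set0.
  by have [_ _ h _ _] := HM; exact: h (valP T).
exists (span gens), b; split; last split=> //.
  move=> v; split.
    move=> vg; rewrite (@coord_span _ _ _ (in_tuple gens) v vg).
    apply: (big_ind (B3h0 Omega)).
    - exact: (B3h0_0 HM).
    - by move=> x y hx hy; rewrite -[x]scale1r; exact: (B3h0_scaleD HOmega Hsc HM).
    - move=> i _; rewrite -[_ *: _]addr0.
      apply: (B3h0_scaleD HOmega Hsc HM); last exact: (B3h0_0 HM).
      have /gensP[j nbj ->] : gens`_i \in gens by exact: mem_nth.
      exact: phiB.
  move=> /(B3h0_data HOmega Hsc HM)[f [f0 hf]].
  have -> : v = \sum_j f j *: phi j.
    apply/ffunP => T; have [T3 intT] := tri T; have [injp _ _ _ _] := HM.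
    apply: (agree_unique T3 injp intT (hf T)).
    have key (s : seq (dof M)) : agree ((\sum_(j <- s) f j *: phi j) T)
        (fun i => \sum_(j <- s) f j * unit_dof j i) (val T).
      elim: s => [|j s IH].
        rewrite big_nil ffunE; apply: eq_agree (agree0 _) => i.
        by rewrite big_nil.
      rewrite big_cons !ffunE; apply: eq_agree (agreeD (f j) (hphi j T) IH) => i.
      by rewrite big_cons.
    apply: eq_agree (key _) => i.
    rewrite (bigD1 i) //= /unit_dof eqxx mulr1 big1 ?addr0 // => j ji.
    by rewrite eq_sym (negbTE ji) mulr0.
  apply: memv_suml => j _.
  have [bj|nbj] := pselect (on_boundary Omega j); first by rewrite f0 // scale0r mem0v.
  apply/memvZ/memv_span/map_f; rewrite mem_filter mem_enum andbT.
  exact/asboolPn.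
move=> v /bg /gensP[j _ ->].
(* On a triangle that does not contain a, all the data of phi j are 0. *)
exists (match j with inl (a, _) => a | inr (a, _) => a end) => T x Tx nx.
set a := match j with inl (a, _) => a | inr (a, _) => a end in nx.
have aT : a \notin val T.
  by apply/negP => aT; apply: nx; exists (val T) => //; split => //; exact: valP.
have [T3 intT] := tri T; have [injp _ _ _ _] := HM.
suff -> : restr (phi j) T = peval (0 : poly2 R 3).
  by rewrite -[0](scale0r (0 : poly2 R 3)) pevalZ mul0r.
congr peval; apply: (agree_eq0 T3 injp intT).
have out u w i : u \in val T -> w \in val T ->
    unit_dof j (inl (u, i)) = 0 /\ unit_dof j (inr (u, w)) = 0.
  move=> uT wT; rewrite /unit_dof; split; case: eqP => // e.
    by move: aT; rewrite /a -e uT.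
  by move: aT; rewrite /a -e uT.
have [h1 h2 h3 h4] := hphi j T; split.
- by move=> u uT; rewrite h1 // (out u u 0 uT uT).1.
- by move=> u w uT wT; rewrite h2 // (out u u 1 uT uT).1 (out w w 1 wT wT).1.
- by move=> u w uT wT; rewrite h3 // (out u u 2 uT uT).1 (out w w 2 wT wT).1.
- by move=> u w uT wT; rewrite h4 // (out u w 0 uT wT).2 (out w u 0 wT uT).2.
Qed.
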